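(* Let $X$ be a random vector in $\Omega_X\subset\mathbb{R}^p$ and $Y$ a random element of $\Omega_Y\subset\mathcal{Y}$, where $(\mathcal{Y},d_{\mathcal{Y}})$ is a separable metric space, such that the family of conditional distributions $\{P_{X\mid Y}(\cdot\mid y):y\in\Omega_Y\}$ is dominated by a $\sigma$-finite measure. Let $\mathcal{G}_{Y\mid X}$ be the central $\sigma$-field, $\mathfrak{S}_{\mathcal{G}_{Y\mid X}}$ the central class, and $\mathfrak{S}^\perp_{\mathcal{G}_{Y\mid X}}$ its orthogonal complement in $L_2(P_X)$. Then: (a) For any $g\in\mathfrak{S}^\perp_{\mathcal{G}_{Y\mid X}}$, $\mathrm{FCCov}(g(X)\mid Y)=0$. (b) Let $m$ be any positive integer. Then the optimal solution $\boldsymbol{f}^*=(f_1^*,\dots,f_m^* )^\top$ of $$\max_{f_1,\dots,f_m\in L_2(P_X)}\ \sum_{t=1}^m\mathrm{FCCov}(f_t(X)\mid Y)\quad\text{subject to}\quad\operatorname{Var}\{\boldsymbol{f}(X)\}=\mathbf{I}_m,\qquad \boldsymbol f=(f_1,\dots,f_m)^\top,$$ satisfies $f_j^*\in\mathfrak{S}_{\mathcal{G}_{Y\mid X}}$ for all $1\le j\le m$.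
   Context: $P_X$ is the distribution of $X$; $L_2(P_X)$ is the space of real functions on $\Omega_X$ square-integrable with respect to $P_X$, with its usual inner product. $\mathbf I_m$ is the $m\times m$ identity matrix. Central $\sigma$-field: $\mathcal{G}_{Y\mid X}$ is the unique minimal sub-$\sigma$-field of $\sigma(X)$ such that $Y$ and $X$ are conditionally independent given $\mathcal{G}_{Y\mid X}$ (it exists and is unique under the domination assumption). Central class: $\mathfrak{S}_{\mathcal{G}_{Y\mid X}}$ is the set of $f\in L_2(P_X)$ such that $f(X)$ is $\mathcal{G}_{Y\mid X}$-measurable, and $L_2(P_X)=\mathfrak{S}_{\mathcal{G}_{Y\mid X}}\oplus\mathfrak{S}^\perp_{\mathcal{G}_{Y\mid X}}$ is the orthogonal decomposition. Fréchet cumulative covariance: assume $E\,d_{\mathcal{Y}}^2(Y,\tilde Y)<\infty$, where $\bar Y,\tilde Y$ are independent copies of $Y$, independent of each other and of $(X,Y)$. For $f\in L_2(P_X)$, $$\mathrm{FCCov}(f(X)\mid Y)=E\left[\operatorname{cov}^2\left\{f(X),\,I[d_{\mathcal{Y}}(Y,\tilde Y)<d_{\mathcal{Y}}(\bar Y,\tilde Y)]\;\middle|\;\bar Y,\tilde Y\right\}\right],$$ where $I[\cdot]$ is an indicator and the inner covariance is conditional on $(\bar Y,\tilde Y)$.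
   Formalization: Part (b) adds that some m functions in L_2(P_X) have FCCov > 0 on every nontrivial linear combination; without it (b) fails, e.g. for X normal and independent of Y, where every feasible f is optimal but the central class is only the constants. *)

(* Defs.v *)
From HB Require Import structures.
From mathcomp Require Import all_boot all_order all_algebra.
From mathcomp Require Import all_classical all_reals all_analysis.

Set Implicit Arguments.
Unset Strict Implicit.
Unset Printing Implicit Defensive.

Import Order.TTheory GRing.Theory Num.Theory.
Import numFieldNormedType.Exports.

Local Open Scope classical_set_scope.
Local Open Scope ring_scope.

(* [metricType] does not include a point, whereas [measurableType] does. *)
#[short(type="pmetricType")]
HB.structure Definition PointedMetric (K : numDomainType) :=
  { M of Metric K M & Pointed M }.

Definition separable (T : topologicalType) : Prop :=
  exists D : set T, countable D /\ dense D.

Definition borel (T : ptopologicalType) := g_sigma_algebraType (@open T).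

Notation rvec R p := (borel 'rV[R]_p).

Section conditioning.
Context {d} {T : measurableType d} {R : realType} (P : probability T R).
Implicit Types (F G H : set_system T) (U V Z : T -> R).

(* Z is a version of E[U | G]; the first clause is sigma(Z) `<=` G. *)
Definition is_condE G U Z : Prop :=
  [/\ g_sigma_algebra_preimage Z `<=` G,
      Z \in Lfun P 1%E &
      forall C, G C ->
        \int[P]_(t in C) (Z t)%:E = \int[P]_(t in C) (U t)%:E]%E.

(* Arbitrary but fixed version; versions agree P-almost surely. *)
Definition condE G U : T -> R := get [set Z | is_condE G U Z].

Definition cond_cov G U V : T -> R :=
  condE G (U \* V) \- condE G U \* condE G V.

(* P(A & B | G) = P(A | G) P(B | G) a.s. for A in F and B in H. *)
Definition cond_indep G F H : Prop :=
  forall A B, F A -> H B ->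
  exists qA qB : T -> R,
    [/\ is_condE G \1_A qA, is_condE G \1_B qB &
        is_condE G \1_(A `&` B) (qA \* qB)].

End conditioning.

Section central.
Context {d d' : measure_display} {T : measurableType d}
  {YT : measurableType d'} {R : realType} {p : nat}.
Variables (P : probability T R) (X : {RV P >-> rvec R p}) (Y : {RV P >-> YT}).

(* Sub-sigma-fields of sigma(X) are taken modulo P-null sets, as usual for
   minimal sufficiency: they contain the null sets of sigma(X).  Without this,
   altering a sufficient sigma-field on null sets gives incomparable ones and
   no least one exists. *)
Definition sufficient_field (G : set_system T) : Prop :=
  [/\ sigma_algebra setT G,
      G `<=` g_sigma_algebra_preimage X,
      (forall A, g_sigma_algebra_preimage X A -> P A = 0%E -> G A) &
      cond_indep P G (g_sigma_algebra_preimage Y) (g_sigma_algebra_preimage X)].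

Definition central_field (G : set_system T) : Prop :=
  sufficient_field G /\ (forall G', sufficient_field G' -> G `<=` G').

(* X takes values in Omega_X, so a function on Omega_X enters only through
   f(X): it is represented by any Borel extension to R^p. *)
Definition L2 (f : rvec R p -> R) : Prop := f \in Lfun (distribution P X) 2%:E.

Definition central_class (G : set_system T) (f : rvec R p -> R) : Prop :=
  L2 f /\ g_sigma_algebra_preimage (f \o X) `<=` G.

Definition central_class_orth (G : set_system T) (g : rvec R p -> R) : Prop :=
  L2 g /\
  forall s, central_class G s ->
    (\int[distribution P X]_x (g x * s x)%:E = 0)%E.

(* kappa is a regular version of P_{X|Y}. *)
Definition is_cond_distribution (kappa : R.-pker YT ~> rvec R p) : Prop :=
  forall (A : set (rvec R p)) (B : set YT), measurable A -> measurable B ->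
    (P (X @^-1` A `&` Y @^-1` B) = \int[distribution P Y]_(y in B) kappa y A)%E.

Definition indep_copies (Ybar Ytil : {RV P >-> YT}) : Prop :=
  [/\ (forall B : set YT, measurable B ->
         distribution P Ybar B = distribution P Y B),
      (forall B : set YT, measurable B ->
         distribution P Ytil B = distribution P Y B) &
      forall (C : set (rvec R p * YT)) (B1 B2 : set YT),
        measurable C -> measurable B1 -> measurable B2 ->
        P ((fun t => (X t, Y t)) @^-1` C `&` Ybar @^-1` B1 `&` Ytil @^-1` B2)
        = (P ((fun t => (X t, Y t)) @^-1` C)
           * P (Ybar @^-1` B1) * P (Ytil @^-1` B2))%E].

Definition var_mx (m : nat) (f : 'I_m -> rvec R p -> R) : 'M[R]_m :=
  \matrix_(i, j) fine (covariance P (f i \o X) (f j \o X)).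

End central.

Section FCCov.
Context {d : measure_display} {T : measurableType d} {R : realType} {p : nat}
  {YT : pmetricType R}.
Variables (P : probability T R) (X : {RV P >-> rvec R p})
  (Y Ybar Ytil : {RV P >-> borel YT}).

(* I[d(Y, Ytil) < d(Ybar, Ytil)] *)
Definition closer (t : T) : R :=
  ((mdist (Y t : YT) (Ytil t) : R) < mdist (Ybar t : YT) (Ytil t))%R%:R.

Definition FCCov (f : rvec R p -> R) : \bar R :=
  ('E_P[(fun t => cond_cov P
    (g_sigma_algebra_preimage (fun s => (Ybar s, Ytil s)))
    (f \o X) closer t ^+ 2)%R])%E.

Definition feasible (m : nat) (f : 'I_m -> rvec R p -> R) : Prop :=
  (forall j, L2 X (f j)) /\ var_mx X f = 1%:M.

Definition optimal (m : nat) (f : 'I_m -> rvec R p -> R) : Prop :=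
  feasible f /\
  forall g : 'I_m -> rvec R p -> R, feasible g ->
    (\sum_(t < m) FCCov (g t) <= \sum_(t < m) FCCov (f t))%E.

(* The quadratic form FCCov has rank at least m.  If it has smaller rank, an
   optimal f may be completed by arbitrary functions of zero FCCov (when X and
   Y are independent, every feasible f is optimal), and optimality says
   nothing about the central class. *)
Definition FCCov_rank_ge (m : nat) : Prop :=
  exists w : 'I_m -> rvec R p -> R,
    (forall i, L2 X (w i)) /\
    forall a : 'rV[R]_m, a != 0 ->
      (0 < FCCov (fun x => (\sum_(i < m) a ord0 i * w i x)%R))%E.

End FCCov.

(* Main.v *)
(* Let S be the central class, I_ab = 1[d(Y, b) < d(a, b)] and
   k_f(a, b) = cov(f(X), I_ab).  As (Ybar, Ytil) is independent of (X, Y),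
   FCCov f is the integral of k_f^2 against the law of (Ybar, Ytil): a
   nonnegative quadratic form in f, with polar form b.
   If g is orthogonal to S then E[g(X) 1_A] = 0 for A in sigma(Y), because by
   sufficiency E[1_A | X] is G-measurable and so lies in S.  Hence k_g = 0.
   Let f be optimal and a a unit vector, f_a = sum_i a_i f_i.  Replacing the
   direction f_a by h keeps f orthonormal and gives
   b(h, h) <= b(f_a, f_a) Var h whenever h is uncorrelated with the part of
   span f orthogonal to f_a.  If some g orthogonal to S had a nonzero vector of
   covariances with f, take a along it: stationarity in the direction
   g - sum_i cov(g, f_i) f_i forces b(f_a, f_a) = 0, and then b vanishes on all
   such h, against the rank hypothesis.  So each f_i is orthogonal to the
   orthogonal complement of S.
   Finally such an f is in S: with q = E[1{f(X) <= r} | G], orthogonality to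
   1{f(X) <= r} - q gives E[(f(X) - r)(1{f(X) <= r} - q)] = 0, whose integrand
   is nonpositive.  So q = 1{f(X) <= r} almost surely off {f(X) = r}, and
   {f(X) < r} is, up to a null set of sigma(X), a countable union of sets
   {q = 1} of G. *)
From HB Require Import structures.
Require Import Defs.
From mathcomp Require Import all_boot all_order all_algebra.
From mathcomp Require Import all_classical all_reals all_analysis.
From mathcomp Require Import measurable_realfun.
From mathcomp Require Import ring lra.

Set Implicit Arguments.
Unset Strict Implicit.
Unset Printing Implicit Defensive.

Import Order.TTheory GRing.Theory Num.Theory.
Import numFieldNormedType.Exports.

Local Open Scope classical_set_scope.
Local Open Scope ring_scope.

(** * Optimal orthonormal families for a quadratic form *)

Section bilinear_form.
Context {R : comPzRingType} {V : lmodType R} (q : V -> V -> R).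
Hypothesis qC : forall u v, q u v = q v u.
Hypothesis qP : forall a u v w, q (a *: u + v) w = a * q u w + q v w.

Lemma form0l w : q 0 w = 0.
Proof. by have := qP (-1) 0 0 w; rewrite scaler0 addr0 mulN1r addNr. Qed.

Lemma formZl a u w : q (a *: u) w = a * q u w.
Proof. by rewrite -[a *: u]addr0 qP form0l addr0. Qed.

Lemma formDl u v w : q (u + v) w = q u w + q v w.
Proof. by rewrite -[u]scale1r qP scale1r mul1r. Qed.

Lemma formBl u v w : q (u - v) w = q u w - q v w.
Proof. by rewrite formDl -scaleN1r formZl mulN1r. Qed.

Lemma formZr a u w : q w (a *: u) = a * q w u.
Proof. by rewrite qC formZl qC. Qed.

Lemma formDr u v w : q w (u + v) = q w u + q w v.
Proof. by rewrite qC formDl !(qC w). Qed.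

Lemma formBr u v w : q w (u - v) = q w u - q w v.
Proof. by rewrite qC formBl !(qC w). Qed.

Lemma form_suml (I : finType) (F : I -> V) w :
  q (\sum_i F i) w = \sum_i q (F i) w.
Proof.
apply: (big_morph (q ^~ w)); [by move=> u v; exact: formDl|exact: form0l].
Qed.

Definition formE := (formBl, formBr, formDl, formDr, formZl, formZr).

End bilinear_form.

Section two_forms.
Context {R : rcfType} {V : lmodType R}.
Variables (c b : V -> V -> R).
Hypothesis cC : forall u v, c u v = c v u.
Hypothesis bC : forall u v, b u v = b v u.
Hypothesis cP : forall a u v w, c (a *: u + v) w = a * c u w + c v w.
Hypothesis bP : forall a u v w, b (a *: u + v) w = a * b u w + b v w.
Hypothesis c_ge0 : forall u, 0 <= c u u.
Hypothesis b_ge0 : forall u, 0 <= b u u.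

Let cE := formE cC cP.
Let bE := formE bC bP.

(** When [b g g = 0], the value of [b] at [t *: g + u] is affine in [t], and a nonnegative affine
    function has zero slope. The chosen [t] would make that value -1. *)
Lemma psd_form_kernel u g : b g g = 0 -> b u g = 0.
Proof.
move=> bg0; apply/eqP/negPn/negP => bug0.
pose t := - (b u u + 1) / (2 * b u g).
have := b_ge0 (t *: g + u).
rewrite !bE bg0 (bC g u) !mulr0 add0r.
have -> : t * b u g + (t * b u g + b u u) = 2 * (t * b u g) + b u u by ring.
have -> : 2 * (t * b u g) = - (b u u + 1) by rewrite /t; field.
lra.
Qed.

Variables (m : nat) (f : 'I_m -> V).
Hypothesis cb0 : forall u, c u u = 0 -> b u u = 0.
Hypothesis fI : forall i j, c (f i) (f j) = (i == j)%:R.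
Hypothesis f_opt : forall g : 'I_m -> V,
  (forall i j, c (g i) (g j) = (i == j)%:R) ->
  \sum_i b (g i) (g i) <= \sum_i b (f i) (f i).

Let comb (a : 'I_m -> R) := \sum_i a i *: f i.

Let c_comb a i : c (comb a) (f i) = a i.
Proof.
rewrite (form_suml cP) (bigD1 i)//= !cE fI eqxx mulr1 big1 ?addr0// => j ji.
by rewrite !cE fI (negbTE ji) mulr0.
Qed.

(* The competitor is f_i - a_i (comb a) + a_i h / sqrt (c h h). *)
Lemma optimal_direction (a : 'I_m -> R) h : \sum_i a i ^+ 2 = 1 ->
  (forall i, c h (f i - a i *: comb a) = 0) ->
  b h h <= b (comb a) (comb a) * c h h.
Proof.
move=> a1 hf; set u := comb a.
have [ch0|ch0] := eqVneq (c h h) 0; first by rewrite ch0 mulr0 cb0.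
have cuu : c u u = 1.
  rewrite /u {1}/comb (form_suml cP) -a1; apply: eq_bigr => i _.
  by rewrite !cE cC c_comb expr2.
have ch_gt0 : 0 < c h h by rewrite lt_def ch0 c_ge0.
pose s := (Num.sqrt (c h h))^-1.
have s2 : s ^+ 2 * c h h = 1 by rewrite exprVn sqr_sqrtr ?c_ge0// mulVf.
have chf i : c h (f i) = a i * c h u.
  by apply/eqP; rewrite -subr_eq0; apply/eqP; rewrite -[RHS](hf i) !cE.
pose g i := f i - a i *: u + a i *: (s *: h).
have gI i j : c (g i) (g j) = (i == j)%:R.
  rewrite /g !cE fI (cC (f i) u) !c_comb cuu (cC (f i) h) (cC u h) !chf.
  ring: s2.
have := f_opt gI.
(* The cross terms collapse because the [a i *: f i] sum to [u] and the [a i ^+ 2] sum to 1: the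
   objective loses [b u u] and gains the normalised value at [h]. *)
have -> : \sum_i b (g i) (g i) = \sum_i b (f i) (f i) - b u u + s ^+ 2 * b h h.
  transitivity (\sum_i (b (f i) (f i)
     + (a i ^+ 2 * (b u u - 2 * (s * b h u) + s ^+ 2 * b h h)
     + (2 * s) * (a i * b (f i) h) - 2 * (a i * b (f i) u)))).
    by apply: eq_bigr => i _; rewrite /g !bE (bC u (f i)) (bC h (f i)) (bC u h);
      ring.
  rewrite big_split/= sumrB big_split/= -mulr_suml a1 -!mulr_sumr.
  have bu w : \sum_i a i * b (f i) w = b u w.
    by rewrite /u (form_suml bP); apply: eq_bigr => i _; rewrite !bE.
  by rewrite !bu (bC h u); ring.
rewrite -addrA gerDl => le0.
rewrite -ler_pdivrMr// mulrC.
have -> : (c h h)^-1 = s ^+ 2 by rewrite exprVn sqr_sqrtr ?c_ge0.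
lra.
Qed.

Hypothesis b_rank : exists w : 'I_m -> V, forall a : 'rV[R]_m, a != 0 ->
  0 < b (\sum_i a ord0 i *: w i) (\sum_i a ord0 i *: w i).

(** The [m] constraints of [optimal_direction] on [h] are dependent, since the vectors
    [f j - a j *: comb a] weighted by [a] sum to 0. So some nonzero combination of the [w i] meets
    all of them; a zero value at [comb a] would make [b] nonpositive there, against [b_rank]. *)
Lemma optimal_direction_gt0 (a : 'I_m -> R) : \sum_i a i ^+ 2 = 1 ->
  0 < b (comb a) (comb a).
Proof.
move=> a1; rewrite lt_def b_ge0 andbT; apply/negP => /eqP bu0.
have [w wP] := b_rank.
pose A := \matrix_(i, j) c (w i) (f j - a j *: comb a).
have : \det A == 0.
  rewrite -det_tr; apply/det0P; exists (\row_i a i).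
    apply/eqP => /rowP a0; move: a1; rewrite big1 => [/eqP|i _].
      by rewrite eq_sym oner_eq0.
    by have := a0 i; rewrite !mxE => ->; rewrite expr0n.
  apply/rowP => i; rewrite !mxE.
  under eq_bigr do rewrite !mxE.
  under eq_bigr do rewrite -(formZr cC cP) cC.
  rewrite -(form_suml cP).
  suff -> : \sum_j a j *: (f j - a j *: comb a) = 0 by rewrite (form0l cP).
  under eq_bigr do rewrite scalerBr scalerA -expr2.
  by rewrite sumrB -scaler_suml a1 scale1r subrr.
(* The row vector [a] is in the kernel of the transpose of [A]; the singular [A] then has a kernel
   row [x] of its own, giving the coefficients of [h]. *)
case/det0P => x x0 xA.
have := @optimal_direction a (\sum_i x ord0 i *: w i) a1.
rewrite bu0 mul0r => H.
have := wP _ x0; rewrite ltNge H// => j.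
rewrite (form_suml cP); move/rowP : xA => /(_ j); rewrite !mxE => xAj.
by rewrite -[RHS]xAj; apply: eq_bigr => i _; rewrite !mxE (formZl cP).
Qed.

(* optimal_direction at h = e u + comb a, to first order in e. *)
Lemma optimal_stationary (a : 'I_m -> R) u : \sum_i a i ^+ 2 = 1 ->
  (forall i, c u (f i) = 0) -> b (comb a) u = 0.
Proof.
move=> a1 uf; set v := comb a.
have uv : c u v = 0.
  by rewrite cC (form_suml cP) big1// => i _; rewrite !cE cC uf mulr0.
have vv : c v v = 1.
  rewrite /v {1}/comb (form_suml cP) -a1; apply: eq_bigr => i _.
  by rewrite !cE cC c_comb expr2.
have H e : 2 * (e * b v u) + e ^+ 2 * b u u <= e ^+ 2 * (b v v * c u u).
  have := @optimal_direction a (e *: u + v) a1.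
  rewrite -/v => /(_ _)/wrap[i|].
    by rewrite !cE uv uf vv c_comb; ring.
  rewrite !cE !bE (bC u v) (cC v u) uv vv.
  lra.
set K := b v v * c u u - b u u in H.
apply/eqP/negPn/negP => bvu.
(* With [L] positive and at least [K], the step [e = b v u / L] makes the linear term twice
   [b v u ^+ 2 / L], while the quadratic term is at most once that amount. *)
pose L := `|K| + 1.
have L0 : 0 < L by rewrite ltr_wpDl.
have := H (b v u / L).
have d2 : 0 < b v u ^+ 2 / L by rewrite divr_gt0// exprn_even_gt0.
have KL : K <= L by rewrite /L; have := ler_norm K; lra.
have -> : b v u / L * b v u = b v u ^+ 2 / L by ring.
have : (b v u / L) ^+ 2 * K <= (b v u ^+ 2 / L).
  have -> : b v u ^+ 2 / L = (b v u / L) ^+ 2 * L by field; exact: lt0r_neq0.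
  by rewrite ler_wpM2l// sqr_ge0.
rewrite /K; lra.
Qed.

Lemma optimal_orth_kernel g i : b g g = 0 -> c (f i) g = 0.
Proof.
move=> bg0; apply/eqP/negPn/negP => cfg.
pose k := \sum_j c g (f j) ^+ 2.
have k_gt0 : 0 < k.
  rewrite /k (bigD1 i)//= ltr_wpDr//.
    by apply: sumr_ge0 => j _; exact: sqr_ge0.
  by rewrite cC exprn_even_gt0.
pose n := (Num.sqrt k)^-1.
have n2 : n ^+ 2 * k = 1 by rewrite exprVn sqr_sqrtr ?mulVf ?gt_eqF// ltW.
have n_neq0 : n != 0 by rewrite invr_eq0 gt_eqF// sqrtr_gt0.
pose a j := n * c g (f j).
have a1 : \sum_j a j ^+ 2 = 1.
  by under eq_bigr do rewrite exprMn; rewrite -mulr_sumr.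
have na : \sum_j c g (f j) *: f j = n^-1 *: comb a.
  rewrite scaler_sumr; apply: eq_bigr => j _.
  by rewrite scalerA /a mulKf.
(* Subtracting the projection makes [g] uncorrelated with every [f j]. As [psd_form_kernel] kills
   [b (comb a) g], only a nonzero multiple of [b (comb a) (comb a)] remains. *)
have := @optimal_stationary a (g - \sum_j c g (f j) *: f j) a1.
move=> /(_ _)/wrap[j|]; first by rewrite (formBl cP) c_comb subrr.
rewrite na !bE psd_form_kernel// sub0r => /eqP.
rewrite oppr_eq0 mulf_eq0 invr_eq0 (negbTE n_neq0)/=.
by rewrite gt_eqF// optimal_direction_gt0.
Qed.

End two_forms.

(** * Versions of conditional expectations *)

Section subfield.
Context {d} {T : measurableType d} {R : realType} (P : probability T R).
Variable G : set_system T.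
Hypothesis sG : sigma_algebra setT G.
Hypothesis Gm : G `<=` measurable.

Local Notation TG := (g_sigma_algebraType G).

Lemma measurable_subfield (A : set T) : (measurable : set (set TG)) A <-> G A.
Proof. by rewrite /measurable/= sigma_algebra_id. Qed.

(** [TG] is [T] carrying [G] as its sigma-field, so the closure lemmas for [measurable_fun] become
    available for [G]-measurability. *)
Lemma sub_preimageP (W : T -> R) :
  g_sigma_algebra_preimage W `<=` G <-> measurable_fun [set: TG] (W : TG -> R).
Proof.
split=> [WG _ B mB|mW _ [B mB <-]].
  by apply/measurable_subfield; apply: WG; exists B.
by apply/measurable_subfield; exact: mW.
Qed.

Lemma subfield_measurable_fun (W : T -> R) :
  g_sigma_algebra_preimage W `<=` G -> measurable_fun setT W.
Proof. by move=> WG _ B mB; apply: Gm; apply: WG; exists B. Qed.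

Local Open Scope ereal_scope.
Import HBNNSimple.

(** [W] is approximated from below by simple functions on [TG]. Their level sets lie in [G], where
    [U] and [Z] integrate alike; monotone convergence does the rest. *)
Lemma ge0_integral_subfield_mul (U Z W : T -> R) :
  measurable_fun setT U -> measurable_fun setT Z ->
  (forall t, 0 <= U t)%R -> (forall t, 0 <= Z t)%R ->
  (forall C, G C -> \int[P]_(t in C) (U t)%:E = \int[P]_(t in C) (Z t)%:E) ->
  (forall t, 0 <= W t)%R -> g_sigma_algebra_preimage W `<=` G ->
  \int[P]_t (U t * W t)%:E = \int[P]_t (Z t * W t)%:E.
Proof.
move=> mU mZ U0 Z0 UZ W0 WG.
have mW : measurable_fun [set: TG] (fun t : TG => (W t)%:E).
  by apply/measurable_EFinP/sub_preimageP.
pose h := nnsfun_approx measurableT mW.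
have mh n : measurable_fun [set: T] (h n : T -> R).
  apply: subfield_measurable_fun; apply/sub_preimageP; exact: measurable_funPT.
have lim (V : T -> R) : measurable_fun setT V -> (forall t, 0 <= V t)%R ->
  \int[P]_t (V t * W t)%:E = limn (fun n => \int[P]_t (V t * h n t)%:E).
  move=> mV V0; rewrite -monotone_convergence//=.
  - apply: eq_integral => t _; apply/esym/cvg_lim => //.
    under eq_fun do rewrite EFinM.
    rewrite EFinM; apply: cvgeZl => //.
    apply: (@cvg_nnsfun_approx _ TG R setT measurableT _ mW) => // x _.
    by rewrite lee_fin.
  - by move=> n; apply/measurable_EFinP/measurable_funM.
  - by move=> n t _; rewrite lee_fin mulr_ge0.
  - move=> t _ n k nk; rewrite lee_fin ler_wpM2l//.
    by have /lefP := @nd_nnsfun_approx _ TG R setT measurableT _ mW n k nk; exact.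
have step (V : T -> R) n : measurable_fun setT V -> (forall t, 0 <= V t)%R ->
  \int[P]_t (V t * h n t)%:E =
  \sum_(r \in range (h n)) r%:E * \int[P]_(t in h n @^-1` [set r]) (V t)%:E.
  move=> mV V0.
  transitivity (\int[P]_t (\sum_(r \in range (h n))
     (r%:E * ((V t)%:E * (\1_(h n @^-1` [set r]) t)%:E)))).
    apply: eq_integral => t _; rewrite (fimfunE (h n) t) EFinM -fsumEFin//.
    rewrite ge0_mule_fsumr//.
      by apply: eq_fsbigr => r _; rewrite EFinM muleCA.
    by move=> r; exact: nnfun_muleindic_ge0.
  have mr r : d.-measurable (h n @^-1` [set r]).
    by rewrite -[X in _.-measurable X]setTI; exact: mh.
  have mVr r : measurable_fun [set: T]
      (fun t => (V t)%:E * (\1_(h n @^-1` [set r]) t)%:E).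
    by apply: emeasurable_funM; apply/measurable_EFinP.
  rewrite ge0_integral_fsum//.
  - apply: eq_fsbigr => r; rewrite inE => -[x _ <-].
    rewrite ge0_integralZl ?lee_fin//.
      congr (_ * _); rewrite [RHS]integral_mkcond; apply: eq_integral => t _.
      by rewrite epatch_indic.
    by move=> t _; rewrite mule_ge0 ?lee_fin.
  - by move=> r; exact: measurable_funeM.
  - move=> r t _; rewrite muleCA mule_ge0 ?lee_fin//.
    exact: nnfun_muleindic_ge0.
rewrite !lim//; congr (limn _); apply/funext => n.
rewrite !step//; apply: eq_fsbigr => r _; congr (_ * _); apply: UZ.
apply/measurable_subfield; rewrite -[X in measurable X]setTI.
exact: measurable_funPT.
Qed.

Lemma integral_subfield_mul (U Z W : T -> R) :
  measurable_fun setT U -> measurable_fun setT Z ->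
  (forall t, 0 <= U t)%R -> (forall t, 0 <= Z t)%R ->
  (forall C, G C -> \int[P]_(t in C) (U t)%:E = \int[P]_(t in C) (Z t)%:E) ->
  g_sigma_algebra_preimage W `<=` G ->
  \int[P]_t (U t * W t)%:E = \int[P]_t (Z t * W t)%:E.
Proof.
move=> mU mZ U0 Z0 UZ WG; rewrite integralE [RHS]integralE.
have Wm : measurable_fun [set: TG] (W : TG -> R) by exact/sub_preimageP.
have pos (V : T -> R) t : (forall t, 0 <= V t)%R ->
    (fun t => (V t * W t)%:E)^\+ t = (V t * W^\+%R t)%:E.
  by move=> V0; rewrite funeposE /funrpos -EFin_max maxr_pMr// mulr0.
have neg (V : T -> R) t : (forall t, 0 <= V t)%R ->
    (fun t => (V t * W t)%:E)^\- t = (V t * W^\-%R t)%:E.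
  move=> V0; rewrite funenegE /funrneg -EFinN -EFin_max.
  by rewrite maxr_pMr// mulr0 mulrN.
under eq_integral do rewrite pos//.
under [X in _ - X]eq_integral do rewrite neg//.
under [X in _ = X - _]eq_integral do rewrite pos//.
under [X in _ = _ - X]eq_integral do rewrite neg//.
congr (_ - _); apply: ge0_integral_subfield_mul => //.
- by apply/sub_preimageP; exact: measurable_funrpos.
- by apply/sub_preimageP; exact: measurable_funrneg.
Qed.

Lemma is_condE_measurable_fun U Z : is_condE P G U Z -> measurable_fun setT Z.
Proof. by case=> ZG _ _; exact: subfield_measurable_fun. Qed.

(** The event where one version is strictly below the other lies in [G], so both have the same
    integral over it; the positive difference integrates to 0 and the event is null. *)
Lemma is_condE_ae_unique U Z Z' :
  is_condE P G U Z -> is_condE P G U Z' -> {ae P, forall t, Z t = Z' t}.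
Proof.
suff H V V' : is_condE P G U V -> is_condE P G U V' ->
    P [set t | (V t < V' t)%R] = 0.
  move=> HZ HZ'.
  have mlt V V' : is_condE P G U V -> is_condE P G U V' ->
      measurable [set t | (V t < V' t)%R].
    move=> /is_condE_measurable_fun mV /is_condE_measurable_fun mV'.
    by rewrite -[X in measurable X]setTI; exact: measurable_fun_ltr.
  exists ([set t | (Z t < Z' t)%R] `|` [set t | (Z' t < Z t)%R]).
  split.
  - by apply: measurableU; exact: mlt.
  - apply/eqP; rewrite -measure_le0.
    rewrite (le_trans (measureU2 _ _ _))//; [exact: mlt..|].
    have H1 := H _ _ HZ HZ'; have H2 := H _ _ HZ' HZ.
    by rewrite [X in X + _]H1 [X in _ + X]H2 add0e.
  - move=> t /= /eqP; rewrite neq_lt => /orP[]; by [left|right].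
move=> {Z Z'}; move: V V' => Z Z'.
case=> ZG Z1 ZE [Z'G Z'1 Z'E].
have mZ := subfield_measurable_fun ZG.
have mZ' := subfield_measurable_fun Z'G.
set A := [set t | _].
have GA : G A.
  apply/measurable_subfield; rewrite -[X in measurable X]setTI.
  by apply: measurable_fun_ltr => //; exact/sub_preimageP.
have mA : measurable A := Gm GA.
have iZ : P.-integrable A (EFin \o Z).
  by apply: (integrableS measurableT) => //; exact/Lfun1_integrable.
have iZ' : P.-integrable A (EFin \o Z').
  by apply: (integrableS measurableT) => //; exact/Lfun1_integrable.
have : \int[P]_(t in A) ((EFin \o Z') t - (EFin \o Z) t) = 0.
  rewrite integralB// -[X in X - _]/(\int[P]_(t in A) (Z' t)%:E).
  rewrite -[X in _ - X]/(\int[P]_(t in A) (Z t)%:E) Z'E// -ZE// subee//.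
  exact: integrable_fin_num.
have e0 : \int[P]_(t in A) `|(EFin \o Z') t - (EFin \o Z) t| =
    \int[P]_(t in A) ((EFin \o Z') t - (EFin \o Z) t).
  apply: eq_integral => t; rewrite inE /A/= => /ltW Zt.
  by rewrite ger0_norm ?EFinB ?subr_ge0.
rewrite -e0; move/(ae_eq_integral_abs P mA); rewrite /ae_eq.
have mB : measurable_fun A (fun t => (EFin \o Z') t - (EFin \o Z) t).
  apply/measurable_EFinP; apply/measurable_funTS/measurable_funB => //.
move=> /(_ mB) [N [mN N0 AN]].
apply/eqP; rewrite -measure_le0 -N0 le_measure ?inE// => t At; apply: AN => /=.
move=> /(_ At); rewrite -EFinB => -[] /eqP; rewrite subr_eq0 => /eqP E.
by move: At; rewrite /A/= E ltxx.
Qed.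

(** The event [q < 0] lies in [G], and the integral of [q] over it is that of an indicator, hence
    nonnegative. *)
Lemma is_condE_indic_ge0 A q : measurable A ->
  is_condE P G \1_A q -> {ae P, forall t, (0 <= q t)%R}.
Proof.
move=> mA [qG q1 qE].
have mq := subfield_measurable_fun qG.
set B := [set t | (q t < 0)%R].
have GB : G B.
  apply/measurable_subfield; rewrite -[X in measurable X]setTI.
  by apply: measurable_fun_ltr => //; exact/sub_preimageP.
have mB : measurable B := Gm GB.
have : \int[P]_(t in B) `|(q t)%:E| <= 0.
  rewrite (eq_integral (fun t => - (q t)%:E)); last first.
    by move=> t; rewrite inE /B/= => /ltW qt; rewrite ler0_norm.
  rewrite integralN/=; last first.
    apply: integrable_add_def => //; apply: (integrableS measurableT) => //.
    exact/Lfun1_integrable.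
  rewrite qE// oppe_le0; by apply: integral_ge0 => t _; rewrite lee_fin.
rewrite le_eqVlt ltNge integral_ge0 ?orbF// => /eqP/ae_eq_integral_abs.
case=> //[|N [mN N0 BN]]; first exact/measurable_EFinP/measurable_funTS.
exists N; split => // t /= /negP; rewrite -ltNge => qt; apply: BN => /= /(_ qt).
by case => q0; rewrite q0 ltxx in qt.
Qed.

(** Through the complement, the lower bound 0 on versions yields the upper bound 1. *)
Lemma is_condE_sub1 A q : measurable A ->
  is_condE P G \1_A q -> is_condE P G \1_(~` A) (fun t => 1 - q t)%R.
Proof.
move=> mA [qG q1 qE]; split.
- apply/sub_preimageP; apply: measurable_funB => //; exact/sub_preimageP.
- by apply: (@rpredB _ (Lfun P 1) (cst 1%R) q) => //; exact: Lfun_cst.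
- move=> C GC; have mC := Gm GC.
  under eq_integral do rewrite EFinB.
  rewrite integralB//; last 2 first.
    exact: finite_measure_integrable_cst.
    by apply: (integrableS measurableT) => //; exact/Lfun1_integrable.
  rewrite qE// integral_cst// mul1e !integral_indic//; last exact: measurableC.
  rewrite (measureDI P mC mA) setDE ![C `&` _]setIC addeK ?fin_num_measure//.
  exact: measurableI.
Qed.

(** Versions lie in [0, 1] only almost surely. Clipping makes the bounds pointwise, as
    [factorization] and the nonnegative integral identities require. *)
Lemma is_condE_indic_clip A q : measurable A -> is_condE P G \1_A q ->
  exists q', [/\ is_condE P G \1_A q', (forall t, 0 <= q' t <= 1)%R &
    {ae P, forall t, q t = q' t}].
Proof.
move=> mA qA; have [qG q1 qE] := qA.
have q_ge0 := is_condE_indic_ge0 mA qA.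
have q_le1 := is_condE_indic_ge0 (measurableC mA) (is_condE_sub1 mA qA).
pose q' t := Num.max 0%R (Num.min 1%R (q t)).
have q'01 t : (0 <= q' t <= 1)%R.
  by rewrite /q' le_max lexx/= ge_max ler01 ge_min lexx.
have q'G : g_sigma_algebra_preimage q' `<=` G.
  apply/sub_preimageP; apply: measurable_maxr => //.
  by apply: measurable_minr => //; exact/sub_preimageP.
have qq' : {ae P, forall t, q t = q' t}.
  move: q_ge0 q_le1; apply: filterS2 => t; rewrite subr_ge0 => q0 q1t.
  by rewrite /q' (min_idPr _)// (max_idPr _).
have mq := subfield_measurable_fun qG.
have mq' := subfield_measurable_fun q'G.
exists q'; split => //; split => //.
- apply/Lfun1_integrable.
  apply: (@le_integrable _ _ _ P setT _ _ (EFin \o cst 1%R)) => //.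
  + exact/measurable_EFinP.
  + move=> t _; rewrite /= lee_fin normr1.
    by have /andP[q0 ?] := q'01 t; rewrite ger0_norm.
  + exact: finite_measure_integrable_cst.
- move=> C GC; rewrite -qE//; have mC := Gm GC.
  apply: ae_eq_integral => //; [exact/measurable_EFinP/measurable_funTS..|].
  by apply: filterS qq' => t -> _.
Qed.

End subfield.

(** * Square integrability, pushforwards and Doob-Dynkin factorization *)

Lemma sqr_integrable_Lfun2 {d} {T : measurableType d} {R : realType}
    (mu : {measure set T -> \bar R}) (f : T -> R) :
  measurable_fun setT f -> mu.-integrable setT (EFin \o (fun x => f x ^+ 2)) ->
  f \in Lfun mu 2%:E.
Proof.
move=> mf /integrableP[_ foo]; rewrite inE; apply/andP.
split; rewrite inE//= /finite_norm unlock poweR_lty//.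
apply: le_lt_trans foo; apply: ge0_le_integral => //.
- by move=> x _; rewrite lee_fin powR_ge0.
- apply/measurable_EFinP/(@measurableT_comp _ _ _ _ _ _ (fun x => x `^ 2)) => //.
  exact: measurableT_comp.
- apply/measurable_EFinP/measurableT_comp => //; exact: measurable_funX.
- by move=> x _; rewrite /= lee_fin powR_mulrn// normrX.
Qed.

Lemma bounded_Lfun2 {d} {T : measurableType d} {R : realType}
    (mu : {finite_measure set T -> \bar R}) (f : T -> R) (k : R) :
  measurable_fun setT f -> (forall x, `|f x| <= k) -> f \in Lfun mu 2%:E.
Proof.
move=> mf fk; apply: sqr_integrable_Lfun2 => //.
apply: (@le_integrable _ _ _ mu setT _ _ (EFin \o cst (k ^+ 2))) => //.
- by apply/measurable_EFinP; exact: measurable_funX.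
- move=> x _ /=; rewrite lee_fin !normrX lerXn2r ?nnegrE//.
  exact: le_trans (fk x) (ler_norm k).
- exact: finite_measure_integrable_cst.
Qed.

Lemma Lfun2_pushforward {d d'} {T : measurableType d} {T' : measurableType d'}
    {R : realType} (P : probability T R) (X : {RV P >-> T'}) (f : T' -> R) :
  f \in Lfun (distribution P X) 2%:E -> f \o X \in Lfun P 2%:E.
Proof.
move=> fL; have mf : measurable_fun setT f.
  by move: fL; rewrite inE => /andP[]; rewrite inE.
apply: sqr_integrable_Lfun2; first exact: measurableT_comp.
have /integrableP[_] := Lfun2_integrable_sqr fL.
rewrite ge0_integral_distribution//=; last first.
  by apply/measurable_EFinP/measurableT_comp => //; exact: measurable_funX.
move=> foo; apply/integrableP; split=> //.
by apply/measurable_EFinP/measurable_funX; exact: measurableT_comp.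
Qed.

(* s is the supremum of the r_n on the sets B_n such that {q > r_n} is the
   preimage of B_n, the r_n being the rationals clipped to [0, 1]. *)
Lemma factorization {T : pointedType} {d'} {T' : measurableType d'}
    {R : realType} (X : T -> T') (q : T -> R) :
  g_sigma_algebra_preimage q `<=` g_sigma_algebra_preimage X ->
  (forall t, 0 <= q t <= 1) ->
  exists s : T' -> R, [/\ measurable_fun setT s, (forall x, 0 <= s x <= 1) &
    q = s \o X].
Proof.
move=> qX q01.
pose r n : R := Num.max 0 (Num.min 1 (ratr (odflt 0 (unpickle n : option rat)))).
have r01 n : 0 <= r n <= 1.
  by rewrite /r le_max lexx/= ge_max ler01 ge_min lexx.
have /choice[B BP] n : exists B : set T', measurable B /\
    X @^-1` B = [set t | r n < q t].
  have /qX[B mB XB] : g_sigma_algebra_preimage q [set t | r n < q t].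
    exists `]r n, +oo[%classic; first exact: measurable_itv.
    by rewrite setTI; apply/seteqP; split => t /=; rewrite in_itv/= andbT.
  by exists B; split => //; rewrite -XB setTI.
pose h n x := r n * \1_(B n) x.
have h01 n x : 0 <= h n x <= 1.
  rewrite /h indicE; case: (_ \in _); rewrite ?mulr1//.
  by rewrite mulr0 lexx ler01.
have hub x : has_ubound (range (h ^~ x)).
  by exists 1 => _ [n _ <-]; have /andP[] := h01 n x.
pose s x := sups (h ^~ x) 0%N.
have sE x : s x = sup (range (h ^~ x)).
  rewrite /s /sups /= /sdrop; congr sup; apply/seteqP; split=> _ [n _ <-].
    by exists n.
  by exists n.
have hs n x : h n x <= s x by rewrite sE; apply: ub_le_sup => //; exists n.
have s_le x k : (forall n, h n x <= k) -> s x <= k.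
  move=> hk; rewrite sE; apply: ge_sup; first by exists (h 0%N x), 0%N.
  by move=> _ [n _ <-].
have s01 x : 0 <= s x <= 1.
  rewrite s_le ?andbT => [|n]; last by have /andP[] := h01 n x.
  by rewrite (le_trans _ (hs 0%N x))//; have /andP[] := h01 0%N x.
exists s; split => //.
- apply: measurable_fun_sups => // n.
  by apply: measurable_funM => //; apply: measurable_indic; have [] := BP n.
- apply/funext => t /=.
  have hE n : h n (X t) = r n * (r n < q t)%R%:R.
    rewrite /h indicE; congr (_ * (nat_of_bool _)%:R).
    have [_ XB] := BP n.
    apply/idP/idP => [/set_mem Bt|rq].
      by have : (X @^-1` B n) t by []; rewrite XB.
    by apply/mem_set; have : [set t | r n < q t] t by []; rewrite -XB.
  apply/eqP; rewrite eq_le; apply/andP; split; last first.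
    apply: s_le => n; rewrite hE.
    have [/ltW rq|_] := ltP (r n) (q t); first by rewrite mulr1.
    by rewrite mulr0; have /andP[] := q01 t.
  rewrite leNgt; apply/negP => sq.
  (* A rational strictly between [s (X t)] and [q t] lies in [0, 1], so clipping leaves it
     unchanged, and it is a value of [h] above the supremum. *)
  have [k] := rat_in_itvoo sq; rewrite in_itv/= => /andP[sk kq].
  have rk : r (pickle k) = ratr k.
    rewrite /r pickleK/= (min_idPr _) ?(max_idPr _)//.
      by apply: le_trans (ltW sk); have /andP[] := s01 (X t).
    by apply: le_trans (ltW kq) _; have /andP[] := q01 t.
  have := hs (pickle k) (X t); rewrite hE rk kq mulr1.
  by rewrite leNgt sk.
Qed.

(** * Conditional independence and the central class *)

Section conditional_independence.
Context {d} {T : measurableType d} {R : realType} (P : probability T R).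
Variables (G F H : set_system T).
Hypothesis sG : sigma_algebra setT G.
Hypothesis Gm : G `<=` measurable.
Hypothesis Fm : F `<=` measurable.
Hypothesis Hm : H `<=` measurable.
Hypothesis HT : H setT.
Hypothesis GFH : cond_indep P G F H.

Local Open Scope ereal_scope.

Let cond_indep_clip A B : F A -> H B ->
  exists qA qB : T -> R, [/\ is_condE P G \1_A qA, is_condE P G \1_B qB,
    (forall t, 0 <= qA t <= 1)%R /\ (forall t, 0 <= qB t <= 1)%R &
    \int[P]_t (qA t * qB t)%:E = P (A `&` B)].
Proof.
move=> FA HB; have [mA mB] := (Fm FA, Hm HB).
have [pA [pB [pA1 pB1 [_ _ /(_ setT)]]]] := GFH FA HB.
rewrite integral_indic ?setIT//; last exact: measurableI.
have GT : G setT by case: sG => G0 GC _; rewrite -(setD0 setT); exact: GC.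
move=> /(_ GT) pAB.
have [qA [qA1 qA01 pqA]] := is_condE_indic_clip sG Gm mA pA1.
have [qB [qB1 qB01 pqB]] := is_condE_indic_clip sG Gm mB pB1.
exists qA, qB; split => //.
have mf := is_condE_measurable_fun Gm.
rewrite -pAB; apply: ae_eq_integral => //.
- by apply/measurable_EFinP/measurable_funM; [exact: mf qA1|exact: mf qB1].
- by apply/measurable_EFinP/measurable_funM; [exact: mf pA1|exact: mf pB1].
- by move: pqA pqB; apply: filterS2 => t /= -> ->.
Qed.

(** With F, H in the roles of sigma(Y), sigma(X): conditioning on H in addition to G does not change
    the conditional probability of [A]. *)
Lemma cond_indep_condE A : F A -> exists q : T -> R,
  [/\ is_condE P G \1_A q, (forall t, 0 <= q t <= 1)%R &
    forall C, H C -> \int[P]_(t in C) (q t)%:E = \int[P]_(t in C) (\1_A t)%:E].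
Proof.
move=> FA; have mA := Fm FA.
have [q [_ [qA _ [q01 _] _]]] := cond_indep_clip FA HT.
exists q; split => // C HC; have mC := Hm HC.
(* [qA'] may vary with [C], unlike [q]. The chain E[qA' qC] = E[1_A qC] = E[q qC] = E[1_C q] passes
   from one to the other, using each time that the other factor is [G]-measurable. *)
have [qA' [qC [qA'A qCC [qA'01 qC01] qAC]]] := cond_indep_clip FA HC.
rewrite integral_indic// -[RHS]qAC.
have ge0 (V : T -> R) : (forall t, 0 <= V t <= 1)%R -> forall t, (0 <= V t)%R.
  by move=> V01 t; have /andP[] := V01 t.
have ind_ge0 (D : set T) t : (0 <= \1_D t :> R)%R by [].
have [qG _ _] := qA; have [qCG _ _] := qCC.
have swap (D : set T) (V W : T -> R) : measurable D -> is_condE P G \1_D V ->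
    (forall t, 0 <= V t <= 1)%R ->
    (forall t, 0 <= W t)%R -> g_sigma_algebra_preimage W `<=` G ->
    \int[P]_t (V t * W t)%:E = \int[P]_t (\1_D t * W t)%:E.
  move=> mD VD V01 W0 WG; apply: (ge0_integral_subfield_mul sG Gm) => //.
  - exact: is_condE_measurable_fun VD.
  - exact: ge0.
  - by move=> E; have [_ _] := VD; exact.
rewrite (swap A)//; last exact: ge0.
rewrite -(swap A q)//; last exact: ge0.
under [RHS]eq_integral do rewrite mulrC.
rewrite (swap C)//; last exact: ge0.
rewrite integral_mkcond; apply: eq_integral => t _.
by rewrite epatch_indic/= EFinM muleC.
Qed.

End conditional_independence.

Section sufficiency.
Context {d d'} {T : measurableType d} {YT : measurableType d'} {R : realType}
  {p : nat} (P : probability T R) (X : {RV P >-> rvec R p})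
  (Y : {RV P >-> YT}) (G : set_system T).
Hypothesis suffG : sufficient_field X Y G.

Let sG : sigma_algebra setT G. Proof. by case: suffG. Qed.

Let GX : G `<=` g_sigma_algebra_preimage X. Proof. by case: suffG. Qed.

Let preimage_measurable d1 (T1 : measurableType d1) (Z : {RV P >-> T1}) :
  g_sigma_algebra_preimage Z `<=` measurable.
Proof. by move=> _ [B mB <-]; exact: measurable_funPT. Qed.

Let Gm : G `<=` measurable.
Proof. exact: subset_trans GX (@preimage_measurable _ _ X). Qed.

Let preimageT d1 (T1 : measurableType d1) (Z : {RV P >-> T1}) :
  g_sigma_algebra_preimage Z setT.
Proof. by exists setT => //; rewrite setTI preimage_setT. Qed.

Let sX : sigma_algebra setT (g_sigma_algebra_preimage X).
Proof. exact: sigma_algebra_preimage (@sigma_algebra_measurable _ _). Qed.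

Lemma L2_comp f : L2 X f -> f \o X \in Lfun P 2%:E.
Proof. exact: Lfun2_pushforward. Qed.

Lemma L2_measurable f : L2 X f -> measurable_fun setT f.
Proof. by rewrite /L2 inE => /andP[]; rewrite inE. Qed.

Lemma L2_integrable_mul f g : L2 X f -> L2 X g ->
  (distribution P X).-integrable setT (fun x => (f x * g x)%:E).
Proof. by move=> fL gL; apply/Lfun1_integrable; exact: Lfun2_mul_Lfun1. Qed.

Lemma L2_integral_mul f g : L2 X f -> L2 X g ->
  (\int[distribution P X]_x (f x * g x)%:E =
   \int[P]_t (f (X t) * g (X t))%:E)%E.
Proof.
move=> fL gL; rewrite integral_distribution//.
- by apply/measurable_EFinP/measurable_funM; exact: L2_measurable.
- apply/Lfun1_integrable; exact: (Lfun2_mul_Lfun1 (L2_comp fL) (L2_comp gL)).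
Qed.

(** Since [g \o X] is sigma(X)-measurable, the indicator may be replaced by a version [q] of P(A |
    G) that integrates like it over sigma(X). Being bounded and [G]-measurable, [q] factors through
    [X] as a member of the central class. *)
Lemma central_orth_indic g (A : set T) : central_class_orth X G g ->
  g_sigma_algebra_preimage Y A ->
  (\int[P]_t (\1_A t * g (X t))%:E = 0)%E.
Proof.
move=> [gL gS] YA; have mA := @preimage_measurable _ _ Y _ YA.
have [_ _ _ GYX] := suffG.
have [q [[qG q1 _] q01 qE]] := cond_indep_condE sG Gm (@preimage_measurable _ _ Y)
  (@preimage_measurable _ _ X) (@preimageT _ _ X) GYX YA.
have [s [ms s01 qs]] := factorization (subset_trans qG GX) q01.
have sL : L2 X s.
  apply: (@bounded_Lfun2 _ _ _ _ _ 1) => // x.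
  by have /andP[s0 ?] := s01 x; rewrite ger0_norm.
rewrite -(@integral_subfield_mul _ _ _ P _ sX (@preimage_measurable _ _ X) q)//.
- have := gS s; rewrite L2_integral_mul// => /(_ _)/wrap[|gs0].
    by split => //; rewrite -qs.
  by rewrite -[RHS]gs0; apply: eq_integral => t _; rewrite qs mulrC.
- exact: subfield_measurable_fun qG.
- by move=> t; have /andP[] := q01 t.
- move=> _ [B mB <-]; exists (g @^-1` B); last by rewrite !setTI.
  by rewrite -[X in measurable X]setTI; exact: L2_measurable gL measurableT _ mB.
Qed.

(** Conditional expectation given [G] is the orthogonal projection onto the central class, so the
    residual of an indicator is orthogonal to it. *)
Lemma central_orth_indic_sub (B : set (rvec R p)) : measurable B ->
  exists s, [/\ central_class X G s, (forall x, 0 <= s x <= 1) &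
    central_class_orth X G (\1_B \- s)].
Proof.
move=> mB; have XB : g_sigma_algebra_preimage X (X @^-1` B).
  by exists B => //; rewrite setTI.
have mXB := @preimage_measurable _ _ X _ XB.
have [_ _ _ GYX] := suffG.
(* Pairing with the trivial event of sigma(Y) supplies a version of P(X in B | G). *)
have [_ [p' [_ pB _]]] := GYX _ _ (@preimageT _ _ Y) XB.
have [q [[qG q1 qE] q01 _]] := is_condE_indic_clip sG Gm mXB pB.
have [s [ms s01 qs]] := factorization (subset_trans qG GX) q01.
have sL : L2 X s.
  apply: (@bounded_Lfun2 _ _ _ _ _ 1) => // x.
  by have /andP[s0 ?] := s01 x; rewrite ger0_norm.
have BL : L2 X \1_B.
  apply: (@bounded_Lfun2 _ _ _ _ _ 1) => // x.
  by rewrite indicE; case: (_ \in _); rewrite ?normr1// normr0.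
have sC : central_class X G s by split => //; rewrite -qs.
exists s; split => //; split.
  by apply: (@rpredB _ (Lfun _ _)) => //; rewrite lee1n.
move=> w [wL wG].
under eq_integral do rewrite mulrBl EFinB.
rewrite integralB//; [|exact: L2_integrable_mul..].
rewrite !L2_integral_mul//.
rewrite (@integral_subfield_mul _ _ _ P _ sG Gm (\1_B \o X) q (w \o X))//.
- rewrite qs/= subee//; apply: integrable_fin_num => //.
  apply/Lfun1_integrable; exact: (Lfun2_mul_Lfun1 (L2_comp sL) (L2_comp wL)).
- exact: measurableT_comp.
- exact: subfield_measurable_fun qG.
- by move=> t; have /andP[] := q01 t.
- by move=> C GC; rewrite qE//.
Qed.

End sufficiency.

(** * The double orthogonal complement of the central class *)

Section double_orthogonal.
Context {d d'} {T : measurableType d} {YT : measurableType d'} {R : realType}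
  {p : nat} (P : probability T R) (X : {RV P >-> rvec R p})
  (Y : {RV P >-> YT}) (G : set_system T).
Hypothesis suffG : sufficient_field X Y G.

Lemma central_orth_integral0 g : central_class_orth X G g ->
  (\int[P]_t (g (X t))%:E = 0)%E.
Proof.
move=> gS; have YT1 : g_sigma_algebra_preimage Y setT.
  by exists setT => //; rewrite setTI preimage_setT.
rewrite -[RHS](central_orth_indic suffG gS YT1); apply: eq_integral => t _.
by rewrite indicT mul1r.
Qed.

Variable f : rvec R p -> R.
Hypothesis fL : L2 X f.
Hypothesis f_orth : forall g, central_class_orth X G g ->
  (\int[P]_t (f (X t) * g (X t))%:E = 0)%E.

Let mf : measurable_fun setT f := L2_measurable fL.

Let ae_level (r : R) : exists A, G A /\
  {ae P, forall t, (f (X t) < r -> A t) /\ (A t -> f (X t) <= r)}.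
Proof.
pose B := f @^-1` `]-oo, r].
have mB : measurable B by rewrite -[X in measurable X]setTI; exact: mf.
have [s [sC s01 gS]] := central_orth_indic_sub suffG mB.
set g := \1_B \- s in gS.
have gL : L2 X g by case: gS.
have g0 := central_orth_integral0 gS.
(* On [B] the factors are [f x - r <= 0] and [1 - s x >= 0]; off [B] they are [f x - r > 0] and
   [- s x <= 0]. *)
have sub0 : forall x, (f x - r) * g x <= 0.
  move=> x; rewrite /g /= indicE; have /andP[s0 s1] := s01 x.
  have [xB|xB] := boolP (x \in B); rewrite /=.
    rewrite mulr_le0_ge0 ?subr_ge0// subr_le0.
    by move: xB; rewrite inE /B /= in_itv.
  rewrite sub0r mulr_ge0_le0 ?oppr_le0// subr_ge0 ltW// ltNge.
  by apply: contra xB => fr; rewrite inE /B /= in_itv.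
have int1 : P.-integrable setT (fun t => ((f (X t) - r) * g (X t))%:E).
  apply/Lfun1_integrable.
  apply: (@Lfun2_mul_Lfun1 _ _ _ _ ((f \o X) \- cst r) (g \o X)).
    apply: (@rpredB _ (Lfun _ _)) => [|le12|le12]; first by rewrite lee1n.
      exact: L2_comp.
    exact: Lfun_cst.
  exact: L2_comp.
have int0 : (\int[P]_t ((f (X t) - r) * g (X t))%:E = 0)%E.
  under eq_integral do rewrite mulrBl EFinB.
  rewrite integralB//.
  - rewrite f_orth//; under eq_integral do rewrite EFinM.
    rewrite integralZl//; last first.
      apply/Lfun1_integrable; apply: Lfun_subset12 (L2_comp gL).
      exact: fin_num_measure.
    by rewrite g0 mule0 subee.
  - by apply/Lfun1_integrable; exact: (Lfun2_mul_Lfun1 (L2_comp fL) (L2_comp gL)).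
  - apply/Lfun1_integrable; apply: (@Lfun2_mul_Lfun1 _ _ _ _ (cst r) (g \o X)).
      exact: Lfun_cst.
    exact: L2_comp.
have ae0 : {ae P, forall t, ((f (X t) - r) * g (X t) = 0)%R}.
  have mh : measurable_fun setT (fun t => ((f (X t) - r) * g (X t))%:E).
    apply/measurable_EFinP/measurable_funM.
      by apply: measurable_funB => //; exact: measurableT_comp.
    by apply: measurableT_comp => //; exact: L2_measurable gL.
  have /(ae_eq_integral_abs P measurableT mh) [N [mN N0 sN]] :
      (\int[P]_t `|((f (X t) - r) * g (X t))%:E| = 0)%E.
    rewrite (eq_integral (fun t => - ((f (X t) - r) * g (X t))%:E))%E.
      by rewrite integralN ?int0 ?oppe0// integrable_add_def.
    by move=> t _; rewrite lee0_abs// lee_fin.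
  exists N; split => // t /= nz; apply: sN => /= /(_ I) [] /eqP.
  by apply/negP/eqP.
(* Where [f (X t) = r] nothing is known about [s]; hence the strict inequality in one implication
   and the weak one in the other. *)
exists [set t | s (X t) = 1]; split.
  have [_ sG] := sC; apply: sG; exists [set 1]; first exact: measurable_set1.
  by rewrite setTI.
apply: filterS ae0 => t; rewrite /g /= indicE => /eqP.
rewrite mulf_eq0 subr_eq0 => /orP[/eqP ->|]; first by rewrite ltxx lexx.
rewrite subr_eq0 => /eqP sE; rewrite -sE; split.
  by move=> fr; rewrite mem_set// /B /= in_itv/= ltW.
have [|_ /eqP] := boolP (X t \in B); first by rewrite inE /B /= in_itv.
by rewrite eq_sym oner_eq0.
Qed.

Lemma central_class_double_orth : central_class X G f.
Proof.
have [sG GX GN _] := suffG.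
have [G0 GC GU] := sG.
split => //; apply/(sub_preimageP sG).
have ltG r : G [set t | f (X t) < r].
  (* Levels strictly below [r] turn the weak bounds into [f (X t) < r], and they increase to [r], so
     the union exhausts the strict sublevel set almost surely. *)
  have /choice[A AP] n := ae_level (r - n.+1%:R^-1).
  set U := \bigcup_n A n; set L := [set t | _].
  have GU' : G U by apply: GU => n; have [] := AP n.
  have XL : g_sigma_algebra_preimage X L.
    exists (f @^-1` `]-oo, r[).
      by rewrite -[X in measurable X]setTI; exact: mf.
    by rewrite setTI; apply/seteqP; split => t /=; rewrite in_itv.
  have aeUL : {ae P, forall t, U t <-> L t}.
    have /ae_foralln : forall n, {ae P, forall t,
      (f (X t) < r - n.+1%:R^-1 -> A n t) /\
      (A n t -> f (X t) <= r - n.+1%:R^-1)}.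
      by move=> n; have [] := AP n.
    apply: filterS => t H; split.
      move=> [n _ /(H n).2 fr]; rewrite /L /=.
      by apply: le_lt_trans fr _; rewrite gtrBl invr_gt0.
    rewrite /L /= => fr; have [n] := @ltr_add_invr R _ _ fr.
    by rewrite -ltrBrDr => fn; exists n => //; exact: (H n).1.
  have mX C : g_sigma_algebra_preimage X C -> measurable C.
    by move=> [B mB <-]; exact: measurable_funPT.
  have sX : sigma_algebra setT (g_sigma_algebra_preimage X).
    exact: sigma_algebra_preimage (@sigma_algebra_measurable _ _).
  have GD (S : set_system T) C D :
    sigma_algebra setT S -> S C -> S D -> S (C `\` D).
    move=> sS /(measurable_subfield sS) SC /(measurable_subfield sS) SD.
    by apply/(measurable_subfield sS); exact: measurableD.
  (* Sets of sigma(X) on which [U] and [L] disagree are null, hence in [G] by the null-set clause of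
     [sufficient_field]. This lets [U] be corrected to [L]. *)
  have null C : g_sigma_algebra_preimage X C ->
    (forall t, C t -> ~ (U t <-> L t)) -> G C.
    move=> XC CUL; apply: GN => //; have [N [mN N0 sN]] := aeUL.
    apply/eqP; rewrite -measure_le0 -N0 le_measure ?inE//; first exact: mX.
    by move=> t /CUL; exact: sN.
  have XU := GX _ GU'.
  have -> : L = (U `\` (U `\` L)) `|` (L `\` U).
    rewrite setDD; apply/seteqP; split => [t Lt|t [[]//|[]//]].
    by have [Ut|nU] := pselect (U t); [left|right].
  apply/(measurable_subfield sG).
  apply: measurableU; apply/(measurable_subfield sG).
    apply: (GD) => //; apply: null; first exact: GD.
    by move=> t [Ut nL] [/(_ Ut)].
  by apply: null; [exact: GD|move=> t [Lt nU] [_ /(_ Lt)]].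
apply: (measurability _ (RGenInftyO.measurableE R)) => //.
move=> _ [_ [r ->] <-]; rewrite setTI; apply/(measurable_subfield sG).
exact: ltG.
Qed.

End double_orthogonal.

(** * Independent copies and FCCov *)

Section metric_measurability.
Context {R : realType} {YT : pmetricType R}.
Hypothesis sepY : separable YT.

Lemma open_mdist_lt (x : YT) (r : R) : open [set y : YT | mdist x y < r].
Proof.
rewrite openE => y /= xy; apply/nbhs_ballP; exists (r - mdist x y) => /=.
  by rewrite subr_gt0.
move=> z; rewrite ballEmdist/= ltrBrDl => yz.
exact: le_lt_trans (metric_triangle _ _ _) yz.
Qed.

Lemma measurable_mdist_lt (x : YT) (r : R) :
  measurable ([set y | mdist x y < r] : set (borel YT)).
Proof. by apply: sub_sigma_algebra; exact: open_mdist_lt. Qed.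

(** Separability is what makes the metric measurable for the product of the Borel sigma-fields: its
    strict sublevel sets are countable unions of rectangles, indexed by dense points and rational
    radii. *)
Lemma measurable_mdist :
  measurable_fun setT (fun z : borel YT * borel YT => mdist (z.1 : YT) z.2).
Proof.
have [D [/pcard_surjP[g gD] denseD]] := sepY.
apply: (measurability _ (RGenInftyO.measurableE R)) => //.
move=> _ [_ [r ->] <-]; rewrite setTI.
have -> : (fun z : borel YT * borel YT => mdist (z.1 : YT) z.2) @^-1` `]-oo, r[ =
    \bigcup_n \bigcup_(q : rat) ([set y | mdist (g n) y < ratr q] `*`
                                 [set y | mdist (g n) y < r - ratr q]).
  apply/seteqP; split=> [[y b]|[y b] [n _ [q _ [/= gy gb]]]] /=;
    rewrite in_itv/=; last first.
    apply: le_lt_trans (metric_triangle _ (g n) _) _.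
    by rewrite (metric_sym y); have := ltrD gy gb; rewrite subrKC.
  (* Half of the slack: a dense point [z] within a rational [q < e] of [y] has distance to [b] below
     [e + mdist y b = r - e], hence below [r - q]. *)
  move=> yb; set e := (r - mdist y b) / 2.
  have e0 : 0 < e by rewrite divr_gt0// subr_gt0.
  have ey : [set z : YT | mdist (y : YT) z < e] (y : YT) by rewrite /= mdistxx.
  have [z [/= yz /gD[n _ nz]]] :=
    denseD _ (ex_intro _ _ ey) (open_mdist_lt (y : YT) e).
  have [q] := rat_in_itvoo yz; rewrite in_itv/= => /andP[yq qe].
  exists n => //; exists q => //=; rewrite nz (metric_sym z); split => //.
  apply: le_lt_trans (metric_triangle _ (y : YT) _) _.
  rewrite (metric_sym z) ltrBrDr.
  have : r = e + e + mdist y b by rewrite /e -splitr subrK.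
  move: yz yq qe; clear; lra.
apply: bigcupT_measurable => n; apply: bigcupT_measurable_rat => q.
by apply: measurableX; exact: measurable_mdist_lt.
Qed.

End metric_measurability.

(** * Fubini and conditioning for independent random elements *)

Section independence.
Context {d d1 d2} {T : measurableType d} {T1 : measurableType d1}
  {T2 : measurableType d2} {R : realType} (P : probability T R).
Variables (V : {RV P >-> T1}) (W : {RV P >-> T2}).
Hypothesis VW : forall A B, measurable A -> measurable B ->
  P (V @^-1` A `&` W @^-1` B) = (P (V @^-1` A) * P (W @^-1` B))%E.

Local Open Scope ereal_scope.

Let pair_mixin := isMeasurableFun.Build _ _ _ _ _
  (measurable_fun_pair (measurable_funPT V) (measurable_funPT W)).
Let pairVW : {RV P >-> (T1 * T2)%type} :=
  HB.pack (fun t => (V t, W t)) pair_mixin.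

Let distribution_pair A : measurable A ->
  (distribution P V \x distribution P W) A = distribution P pairVW A.
Proof.
apply: product_measure_unique => B C mB mC.
by rewrite -VW.
Qed.

Variables (h : (T1 * T2)%type -> R) (u : T1 -> R).
Hypothesis mh : measurable_fun setT h.
Hypothesis uL : u \o V \in Lfun P 1.
Hypothesis hu : forall v w, (`|h (v, w)| <= `|u v|)%R.

Let iu : P.-integrable setT (fun t => `|u (V t)|%:E).
Proof. by have /Lfun1_integrable/integrable_norm := uL. Qed.

(** The dominating [u] involves the first argument alone, so one integrable bound serves all
    sections. *)
Lemma indep_section_integrable w : P.-integrable setT (fun s => (h (V s, w))%:E).
Proof.
apply: le_integrable iu => //.
  apply/measurable_EFinP; apply: measurableT_comp => //.
  by apply: measurable_fun_pair.
by move=> t _ /=; rewrite normr_id lee_fin.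
Qed.

Let mhw w : measurable_fun setT (fun v => (h (v, w))%:E).
Proof.
by apply/measurable_EFinP/measurableT_comp => //; exact: measurable_fun_pair.
Qed.

Let mhw_norm w : measurable_fun setT (fun v => `|h (v, w)|%:E).
Proof.
apply/measurable_EFinP; apply: measurableT_comp => //.
by apply: measurableT_comp => //; exact: measurable_fun_pair.
Qed.

Let hw w : (distribution P V).-integrable setT (fun v => (h (v, w))%:E).
Proof.
apply/integrableP; split.
  exact: mhw.
rewrite ge0_integral_distribution//; last exact: measurableT_comp.
by have /integrableP[] := indep_section_integrable w.
Qed.

Lemma indep_section_integralE w :
  \int[P]_s (h (V s, w))%:E = \int[distribution P V]_v (h (v, w))%:E.
Proof.
rewrite integral_distribution//.
exact: indep_section_integrable.
Qed.

Lemma indep_section_le w :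
  (`|\int[P]_s (h (V s, w))%:E| <= \int[P]_s `|u (V s)|%:E).
Proof.
apply: le_trans (le_abse_integral _ _ _) _ => //.
  by have /integrableP[] := indep_section_integrable w.
apply: ge0_le_integral => //.
- by apply: measurableT_comp => //; have /integrableP[] := indep_section_integrable w.
- by have /integrableP[] := iu.
- by move=> t _; rewrite lee_fin.
Qed.

Let ih : (distribution P V \x distribution P W).-integrable setT (EFin \o h).
Proof.
apply/integrable21ltyP; first exact/measurable_EFinP.
apply: (@le_lt_trans _ _ (\int[distribution P W]_w (\int[P]_s `|u (V s)|%:E))).
  apply: ge0_le_integral => //.
  - by move=> w _; exact: integral_ge0.
  - apply: (measurable_fun_fubini_tonelli_G (abse \o EFin \o h)).
      by apply: measurableT_comp => //; exact/measurable_EFinP.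
    by move=> x; exact: abse_ge0.
  - move=> w _ /=; rewrite ge0_integral_distribution//.
    apply: ge0_le_integral => //.
    + by move=> t _; rewrite lee_fin.
    + exact: (measurableT_comp (mhw_norm w) (measurable_funPT V)).
    + by have /integrableP[] := iu.
    + by move=> t _; rewrite lee_fin.
have PW1 : distribution P W setT = 1 := probability_setT (distribution P W).
rewrite integral_cst// [X in _ * X]PW1 mule1.
by have /integrableP[_] := iu; under eq_integral do rewrite /= normr_id.
Qed.

Lemma indep_measurable_section :
  measurable_fun setT (fun w => \int[P]_s (h (V s, w))%:E).
Proof.
under eq_fun do rewrite indep_section_integralE.
exact: (measurable_fubini_G ih).
Qed.

Lemma indep_comp_integrable : P.-integrable setT (fun t => (h (V t, W t))%:E).
Proof.
apply: le_integrable iu => //; last by move=> t _ /=; rewrite normr_id lee_fin.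
by apply/measurable_EFinP/measurableT_comp => //; exact: measurable_fun_pair.
Qed.

Lemma indep_section_comp_integrable :
  P.-integrable setT (fun t => \int[P]_s (h (V s, W t))%:E).
Proof.
have ucst : P.-integrable setT (cst (\int[P]_s `|u (V s)|%:E)).
  rewrite -(fineK (integrable_fin_num measurableT iu)).
  exact: finite_measure_integrable_cst.
apply: le_integrable ucst => //.
  exact: (measurableT_comp indep_measurable_section (measurable_funPT W)).
move=> t _; apply: le_trans (indep_section_le _) _.
by rewrite /= lee_abs.
Qed.

(** Independence makes the joint law the product of the marginal laws, and Fubini applies. *)
Lemma indep_integral :
  \int[P]_t (h (V t, W t))%:E = \int[P]_t \int[P]_s (h (V s, W t))%:E.
Proof.
transitivity (\int[distribution P W]_w \int[P]_s (h (V s, w))%:E).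
  under [RHS]eq_integral do rewrite indep_section_integralE.
  rewrite [RHS](integral21_prod_meas1 ih).
  rewrite (eq_measure_integral (distribution P pairVW)); last first.
    by move=> A mA _; exact: distribution_pair.
  rewrite integral_distribution//; first exact/measurable_EFinP.
  exact: indep_comp_integrable.
rewrite integral_distribution//; first exact: indep_measurable_section.
exact: indep_section_comp_integrable.
Qed.

End independence.

Lemma indep_condE {d d1 d2} {T : measurableType d} {T1 : measurableType d1}
    {T2 : measurableType d2} {R : realType} (P : probability T R)
    (V : {RV P >-> T1}) (W : {RV P >-> T2}) (h : T1 * T2 -> R) (u : T1 -> R) :
  (forall A B, measurable A -> measurable B ->
    P (V @^-1` A `&` W @^-1` B) = (P (V @^-1` A) * P (W @^-1` B))%E) ->
  measurable_fun setT h -> u \o V \in Lfun P 1 ->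
  (forall v w, `|h (v, w)| <= `|u v|) ->
  is_condE P (g_sigma_algebra_preimage W) (fun t => h (V t, W t))
    (fun t => \int[P]_s h (V s, W t)).
Proof.
move=> VW mh uL hu.
have fineE w : ((\int[P]_s h (V s, w))%:E = \int[P]_s (h (V s, w))%:E)%E.
  rewrite fineK//; apply: integrable_fin_num => //.
  exact: (indep_section_integrable mh uL hu).
split.
- move=> _ [B mB <-].
  exists ((fun w => \int[P]_s h (V s, w)) @^-1` B); last by rewrite !setTI.
  rewrite -[X in measurable X]setTI.
  suff : measurable_fun setT (fun w => \int[P]_s h (V s, w)) by exact.
  apply/measurable_EFinP; rewrite (_ : _ \o _ =
      fun w => (\int[P]_s (h (V s, w))%:E)%E); last exact/funext.
  exact: (indep_measurable_section W mh uL hu).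
- apply/Lfun1_integrable.
  rewrite (_ : _ \o _ = fun t => (\int[P]_s (h (V s, W t))%:E)%E); last first.
    by apply/funext => t; exact: fineE.
  exact: (indep_section_comp_integrable W mh uL hu).
- move=> _ [B mB <-]; rewrite setTI.
  pose hB z := h z * \1_B z.2.
  have mhB : measurable_fun setT hB.
    by apply: measurable_funM => //; apply: measurableT_comp.
  have huB v w : `|hB (v, w)| <= `|u v|.
    rewrite /hB normrM (le_trans _ (hu v w))// ler_piMr// indicE.
    by case: (_ \in _); rewrite ?normr1// normr0.
  have patchE (F : T -> \bar R) :
      (\int[P]_(t in W @^-1` B) F t = \int[P]_t (F t * (\1_B (W t))%:E))%E.
    rewrite integral_mkcond; apply: eq_integral => t _.
    by rewrite epatch_indic/= !indicE.
  rewrite !patchE; under eq_integral do rewrite fineE.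
  have := indep_integral VW mhB uL huB.
  rewrite /hB/= => hBE; under [RHS]eq_integral do rewrite -EFinM.
  rewrite [RHS]hBE; apply: eq_integral => t _.
  under [RHS]eq_integral do rewrite EFinM muleC.
  rewrite integralZl//; first by rewrite muleC.
  exact: (indep_section_integrable mh uL hu).
Qed.

(** * FCCov as a quadratic form *)

Section FCCov_integral.
Context {d : measure_display} {T : measurableType d} {R : realType} {p : nat}
  {YT : pmetricType R}.
Variables (P : probability T R) (X : {RV P >-> rvec R p})
  (Y Ybar Ytil : {RV P >-> borel YT}).
Hypothesis sepY : separable YT.
Hypothesis hcopies : indep_copies X Y Ybar Ytil.

Let XY_mixin := isMeasurableFun.Build _ _ _ _ _
  (measurable_fun_pair (measurable_funPT X) (measurable_funPT Y)).
Let XY : {RV P >-> (rvec R p * borel YT)%type} :=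
  HB.pack (fun t => (X t, Y t)) XY_mixin.

Let Ycopies_mixin := isMeasurableFun.Build _ _ _ _ _
  (measurable_fun_pair (measurable_funPT Ybar) (measurable_funPT Ytil)).
Let Ycopies : {RV P >-> (borel YT * borel YT)%type} :=
  HB.pack (fun t => (Ybar t, Ytil t)) Ycopies_mixin.

(** [indep_copies] gives this for rectangles only. For fixed [A], both sides are measures in [B]
    agreeing on rectangles with the product of [c] times the law of [Ybar] and the law of [Ytil], so
    uniqueness of product measures concludes. *)
Lemma XY_indep_Ycopies A B : measurable A -> measurable B ->
  P (XY @^-1` A `&` Ycopies @^-1` B) = (P (XY @^-1` A) * P (Ycopies @^-1` B))%E.
Proof.
move=> mA mB; have [_ _ indep3] := hcopies.
have mXYA : measurable (XY @^-1` A).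
  by rewrite -[X in measurable X]setTI; exact: measurable_funP.
have c0 : 0 <= fine (P (XY @^-1` A)) by exact: fine_ge0.
pose c : {nonneg R} := NngNum c0.
have cE : c%:num%:E = P (XY @^-1` A) by rewrite fineK// fin_num_measure.
have PY (B1 B2 : set (borel YT)) : measurable B1 -> measurable B2 ->
    (P (Ybar @^-1` B1 `&` Ytil @^-1` B2) =
     P (Ybar @^-1` B1) * P (Ytil @^-1` B2))%E.
  move=> mB1 mB2; have := indep3 setT B1 B2 measurableT mB1 mB2.
  rewrite preimage_setT setTI => ->.
  by have -> : P setT = 1%E := probability_setT P; rewrite mul1e.
have H1 := product_measure_unique (m1 := mscale c (distribution P Ybar))
  (m2 := distribution P Ytil) (m' := mscale c (distribution P Ycopies)) _ mB.
have H2 := product_measure_unique (m1 := mscale c (distribution P Ybar))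
  (m2 := distribution P Ytil) (m' := pushforward (mrestr P mXYA) Ycopies) _ mB.
transitivity (mscale c (distribution P Ycopies) B); last first.
  by rewrite -cE.
rewrite -H1.
  rewrite [RHS]H2; first by rewrite /pushforward/= /mrestr setIC.
  move=> B1 B2 mB1 mB2.
  transitivity (P (XY @^-1` A `&` Ybar @^-1` B1 `&` Ytil @^-1` B2)).
    by rewrite -setIA setIC.
  transitivity (P (XY @^-1` A) * P (Ybar @^-1` B1) * P (Ytil @^-1` B2))%E.
    exact: indep3.
  by rewrite -cE.
move=> B1 B2 mB1 mB2.
rewrite /mscale /= -muleA; congr (_ * _)%E.
exact: PY.
Qed.

(* I_ab at z = ((x, y), (a, b)); cov_ind f (a, b) is k_f(a, b). *)
Definition closer_at (z : (rvec R p * borel YT) * (borel YT * borel YT)) : R :=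
  (mdist (z.1.2 : YT) z.2.2 < mdist (z.2.1 : YT) z.2.2)%R%:R.

Local Notation ind := closer_at.

Let ind_bound z : `|ind z| <= 1.
Proof. by rewrite /closer_at; case: (_ < _); rewrite ?normr1// normr0. Qed.

Let measurable_ind : measurable_fun setT ind.
Proof.
pose A := [set z : (rvec R p * borel YT) * (borel YT * borel YT) |
  mdist (z.1.2 : YT) z.2.2 < mdist (z.2.1 : YT) z.2.2].
have -> : ind = \1_A.
  by apply/funext => z; rewrite indicE /closer_at /A mem_setE.
apply: measurable_indic; rewrite -[X in measurable X]setTI.
apply: measurable_fun_ltr => //.
- apply: (measurableT_comp (measurable_mdist sepY)
    (g := fun z : (rvec R p * borel YT) * (borel YT * borel YT) =>
       (z.1.2, z.2.2))).
  by apply: measurable_fun_pair; apply: measurableT_comp.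
- exact: (measurableT_comp (measurable_mdist sepY) measurable_snd).
Qed.

Definition cov_ind (f : rvec R p -> R) (w : borel YT * borel YT) : R :=
  \int[P]_s (f (X s) * ind ((X s, Y s), w)) -
  (\int[P]_s f (X s)) * \int[P]_s ind ((X s, Y s), w).

Let ind_f f (z : (rvec R p * borel YT) * (borel YT * borel YT)) : R :=
  f z.1.1 * ind z.

Let L2_comp1 f : L2 X f -> f \o X \in Lfun P 1.
Proof.
by move=> /L2_comp; apply: Lfun_subset12; exact: fin_num_measure.
Qed.

Let measurable_ind_f f : L2 X f -> measurable_fun setT (ind_f f).
Proof.
move=> /L2_measurable mf; apply: measurable_funM => //.
by apply: measurableT_comp => //; exact: measurableT_comp.
Qed.

Let ind_f_bound f v w : `|ind_f f (v, w)| <= `|f v.1|.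
Proof. by rewrite normrM ler_piMr. Qed.

Let Lfun1_cst : (cst 1 : rvec R p * borel YT -> R) \o XY \in Lfun P 1.
Proof. exact: (@Lfun_cst _ _ _ P 1 1). Qed.

Let fieldYY := g_sigma_algebra_preimage (fun s => (Ybar s, Ytil s)).

Let condE_ind_f f : L2 X f -> is_condE P fieldYY
  ((f \o X) \* closer Y Ybar Ytil)
  (fun t => \int[P]_s (f (X s) * ind ((X s, Y s), Ycopies t))).
Proof.
move=> fL.
exact: (indep_condE (V := XY) (W := Ycopies) XY_indep_Ycopies
  (measurable_ind_f fL)
  (L2_comp1 fL : (fun v => f v.1) \o XY \in _) (@ind_f_bound f)).
Qed.

Let condE_f f : L2 X f -> is_condE P fieldYY (f \o X) (cst (\int[P]_s f (X s))).
Proof.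
move=> fL.
apply: (indep_condE (V := XY) (W := Ycopies) (h := fun z => f z.1.1)
  (u := fun v => f v.1) XY_indep_Ycopies _ (L2_comp1 fL)) => //.
apply: measurableT_comp; first exact: L2_measurable fL.
exact: measurableT_comp.
Qed.

Let condE_ind : is_condE P fieldYY (closer Y Ybar Ytil)
  (fun t => \int[P]_s ind ((X s, Y s), Ycopies t)).
Proof.
apply: (indep_condE (V := XY) (W := Ycopies)
  XY_indep_Ycopies measurable_ind Lfun1_cst) => v w.
by rewrite normr1.
Qed.

Let sYY : sigma_algebra setT fieldYY.
Proof. exact: sigma_algebra_preimage (@sigma_algebra_measurable _ _). Qed.

Let fieldYY_measurable : fieldYY `<=` measurable.
Proof. by move=> _ [B mB <-]; exact: (measurable_funPT Ycopies). Qed.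

(** [condE] is chosen by [get]: exhibiting one version [Z] shows that the choice is a version too,
    and versions agree almost surely. *)
Let condE_ae U Z : is_condE P fieldYY U Z ->
  {ae P, forall t, condE P fieldYY U t = Z t}.
Proof.
move=> UZ; apply: (is_condE_ae_unique sYY fieldYY_measurable _ UZ).
by apply: getPex; exists Z.
Qed.

Let measurable_condE U Z : is_condE P fieldYY U Z ->
  measurable_fun setT (condE P fieldYY U).
Proof.
move=> UZ; apply: (@is_condE_measurable_fun _ _ _ P _ fieldYY_measurable U).
by apply: getPex; exists Z.
Qed.

Lemma measurable_cov_ind f : L2 X f -> measurable_fun setT (cov_ind f \o Ycopies).
Proof.
move=> fL; apply: measurable_funB.
  exact: is_condE_measurable_fun (condE_ind_f fL).
apply: measurable_funM => //.
exact: is_condE_measurable_fun condE_ind.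
Qed.

Lemma FCCovE f : L2 X f ->
  FCCov X Y Ybar Ytil f = (\int[P]_t (cov_ind f (Ybar t, Ytil t) ^+ 2)%:E)%E.
Proof.
move=> fL; rewrite /FCCov unlock.
apply: ae_eq_integral => //.
- apply/measurable_EFinP/measurable_funX/measurable_funB.
    exact: measurable_condE (condE_ind_f fL).
  apply: measurable_funM.
    exact: measurable_condE (condE_f fL).
  exact: measurable_condE condE_ind.
- exact/measurable_EFinP/measurable_funX/measurable_cov_ind.
- move: (condE_ae (condE_ind_f fL)) (condE_ae (condE_f fL)) (condE_ae condE_ind).
  apply: filterS3 => t E1 E2 E3 _ /=.
  by rewrite /cond_cov /= E1 E2 E3.
Qed.

Let integrable_f f : L2 X f -> P.-integrable setT (fun s => (f (X s))%:E).
Proof. by move=> /L2_comp1/Lfun1_integrable. Qed.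

Let integrable_ind_f f w : L2 X f ->
  P.-integrable setT (fun s => (f (X s) * ind ((X s, Y s), w))%:E).
Proof.
move=> fL; exact: (indep_section_integrable (V := XY) (measurable_ind_f fL)
  (L2_comp1 fL : (fun v => f v.1) \o XY \in _) (@ind_f_bound f) w).
Qed.

Let integrable_ind w : P.-integrable setT (fun s => (ind ((X s, Y s), w))%:E).
Proof.
apply: (indep_section_integrable (V := XY) measurable_ind Lfun1_cst _ w) => v w'.
by rewrite normr1.
Qed.

Let integrableMl (a : R) (h : T -> R) : P.-integrable setT (EFin \o h) ->
  P.-integrable setT (fun t => (a * h t)%:E).
Proof. by move=> ih; exact: (integrableZl measurableT a ih). Qed.

Lemma cov_ind_linear a f g w : L2 X f -> L2 X g ->
  cov_ind (fun x => a * f x + g x) w = a * cov_ind f w + cov_ind g w.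
Proof.
move=> fL gL; rewrite /cov_ind.
have afL : P.-integrable setT (EFin \o (fun s => a * f (X s))).
  exact/integrableMl/integrable_f.
have afi : P.-integrable setT
    (EFin \o (fun s => a * (f (X s) * ind ((X s, Y s), w)))).
  exact/integrableMl/integrable_ind_f.
under [X in X - _]eq_Rintegral do rewrite mulrDl -mulrA.
rewrite [X in X - _]RintegralD// ?[X in X + _ - _]RintegralZl//; last 2 first.
  exact: integrable_ind_f.
  exact: integrable_ind_f.
rewrite [X in _ - X * _]RintegralD// ?[X in _ - (X + _) * _]RintegralZl//;
  last 2 first.
  exact: integrable_f.
  exact: integrable_f.
ring.
Qed.

(** Each of the two terms is at most E|f(X)|, as the indicator is at most 1. Uniformity in [w] makes
    products of [cov_ind] integrable and [cov_form] finite. *)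
Lemma cov_ind_le f w : L2 X f -> `|cov_ind f w| <= 2 * \int[P]_s `|f (X s)|.
Proof.
move=> fL; rewrite /cov_ind.
have ifn : P.-integrable setT (EFin \o (fun s => `|f (X s)|)).
  by apply: integrable_norm; exact: integrable_f.
have H1 : `|\int[P]_s (f (X s) * ind ((X s, Y s), w))| <= \int[P]_s `|f (X s)|.
  apply: le_trans (le_normr_Rintegral _ _) _ => //; first exact: integrable_ind_f.
  apply: le_Rintegral => //; first exact/integrable_norm/integrable_ind_f.
  by move=> s _; exact: ind_f_bound ((X s, Y s)) w.
have H2 : `|\int[P]_s f (X s)| <= \int[P]_s `|f (X s)|.
  by apply: le_normr_Rintegral => //; exact: integrable_f.
have H3 : `|\int[P]_s ind ((X s, Y s), w)| <= 1.
  apply: le_trans (le_normr_Rintegral _ _) _ => //; first exact: integrable_ind.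
  apply: (@le_trans _ _ (\int[P]_s 1)).
    apply: le_Rintegral => //; first exact/integrable_norm/integrable_ind.
    exact: finite_measure_integrable_cst.
  have PT : P setT = 1%E := probability_setT P.
  by rewrite Rintegral_cst// mul1r (_ : fine _ = 1)// -[RHS]/(fine 1%E) -PT.
apply: le_trans (ler_normB _ _) _; rewrite normrM mulrDl mul1r lerD//.
by rewrite -[leRHS]mulr1 ler_pM.
Qed.

Let cov_ind_center f w : L2 X f ->
  cov_ind f w = \int[P]_s ((f (X s) - \int[P]_u f (X u)) * ind ((X s, Y s), w)).
Proof.
move=> fL; rewrite /cov_ind; set m := (X in _ - X * _).
under [RHS]eq_Rintegral do rewrite mulrBl.
have i1 := integrable_ind_f w fL; have i2 := integrable_ind w.
have i3 := integrableMl m i2.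
by rewrite RintegralB// RintegralZl.
Qed.

(** A variable of zero variance is almost surely its mean, so the centred integrand vanishes. This
    supplies the hypothesis [cb0] of the abstract optimisation. *)
Lemma cov_ind_variance0 f w : L2 X f -> 'V_P[f \o X] = 0%E -> cov_ind f w = 0.
Proof.
move=> fL; rewrite /variance unlock unlock => V0.
pose m := \int[P]_s f (X s).
have mfX : measurable_fun setT (f \o X).
  by apply: measurableT_comp (L2_measurable fL) _.
have mc : measurable_fun setT (fun t => ((f (X t) - m) ^+ 2)%:E).
  by apply/measurable_EFinP/measurable_funX/measurable_funB.
have /(ae_eq_integral_abs P measurableT mc) ae0 :
    (\int[P]_t `|((f (X t) - m) ^+ 2)%:E| = 0)%E.
  rewrite -[RHS]V0; apply: eq_integral => t _ /=.
  by rewrite ger0_norm ?sqr_ge0.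
rewrite cov_ind_center// -/m.
rewrite /Rintegral (ae_eq_integral (cst 0%E)) ?integral0//.
- apply/measurable_EFinP/measurable_funM; first exact: measurable_funB.
  apply/measurable_EFinP; exact: measurable_int (integrable_ind w).
- move: ae0; apply: filterS => t /(_ I) [] /eqP; rewrite sqrf_eq0 => /eqP fm _.
  by rewrite fm mul0r.
Qed.

Lemma cov_ind_orth f w : L2 X f ->
  (forall A, g_sigma_algebra_preimage Y A ->
    (\int[P]_t (\1_A t * f (X t))%:E = 0)%E) ->
  cov_ind f w = 0.
Proof.
move=> fL f0; rewrite /cov_ind.
have -> : \int[P]_s f (X s) = 0.
  have YT1 : g_sigma_algebra_preimage Y setT.
    by exists setT => //; rewrite setTI preimage_setT.
  rewrite /Rintegral -[RHS]/(fine 0%E) -(f0 _ YT1); congr fine.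
  by apply: eq_integral => t _; rewrite indicT mul1r.
rewrite mul0r subr0; pose r : R := mdist (w.1 : YT) w.2.
(* With [w] frozen, the indicator is that of [Y] lying in the open ball centred at the second copy
   with the first copy on its sphere: an event of sigma(Y). *)
pose B : set (borel YT) := [set y | mdist (w.2 : YT) y < r].
have YB : g_sigma_algebra_preimage Y (Y @^-1` B).
  by exists B; [exact: measurable_mdist_lt|rewrite setTI].
rewrite /Rintegral -[RHS]/(fine 0%E) -(f0 _ YB); congr fine.
apply: eq_integral => t _; rewrite mulrC; congr (_ * _)%:E.
by rewrite /closer_at indicE mem_setE /B /= (metric_sym (Y t : YT)).
Qed.

(** The polar form b of FCCov. *)
Definition cov_form (f g : rvec R p -> R) : R :=
  \int[P]_t (cov_ind f (Ybar t, Ytil t) * cov_ind g (Ybar t, Ytil t)).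

Lemma integrable_cov_ind_mul f g : L2 X f -> L2 X g -> P.-integrable setT
  (fun t => (cov_ind f (Ybar t, Ytil t) * cov_ind g (Ybar t, Ytil t))%:E).
Proof.
move=> fL gL; apply/Lfun1_integrable.
have bnd h : L2 X h -> (fun t => cov_ind h (Ybar t, Ytil t)) \in Lfun P 2%:E.
  move=> hL; apply: (@bounded_Lfun2 _ _ _ _ _ (2 * \int[P]_s `|h (X s)|)).
    exact: measurable_cov_ind hL.
  by move=> t; exact: cov_ind_le.
exact: (Lfun2_mul_Lfun1 (bnd _ fL) (bnd _ gL)).
Qed.

Lemma FCCov_form f : L2 X f -> FCCov X Y Ybar Ytil f = (cov_form f f)%:E.
Proof.
move=> fL; rewrite FCCovE// /cov_form /Rintegral fineK.
  by apply: eq_integral => t _; rewrite expr2.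
by apply: integrable_fin_num => //; exact: integrable_cov_ind_mul.
Qed.

Lemma cov_form_linear a f g h : L2 X f -> L2 X g -> L2 X h ->
  cov_form (fun x => a * f x + g x) h = a * cov_form f h + cov_form g h.
Proof.
move=> fL gL hL; rewrite /cov_form.
under eq_Rintegral do rewrite cov_ind_linear// mulrDl -mulrA.
rewrite RintegralD ?RintegralZl//; [exact: integrable_cov_ind_mul| |
  exact: integrable_cov_ind_mul].
exact/integrableMl/integrable_cov_ind_mul.
Qed.

End FCCov_integral.

Section variance_form.
Context {d} {T : measurableType d} {R : realType} {p : nat}
  (P : probability T R) (X : {RV P >-> rvec R p}).

Definition variance_form (f g : rvec R p -> R) : R :=
  fine (covariance P (f \o X) (g \o X)).

Lemma variance_form_linear a f g h : L2 X f -> L2 X g -> L2 X h ->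
  variance_form (fun x => a * f x + g x) h =
  a * variance_form f h + variance_form g h.
Proof.
move=> /L2_comp fL /L2_comp gL /L2_comp hL; rewrite /variance_form.
have PT : P setT \is a fin_num by exact: fin_num_measure.
have f1 := Lfun_subset12 PT fL; have g1 := Lfun_subset12 PT gL.
have h1 := Lfun_subset12 PT hL.
have fh := Lfun2_mul_Lfun1 fL hL.
have gh := Lfun2_mul_Lfun1 gL hL.
have -> : (fun x => a * f x + g x) \o X = (a \o* (f \o X)) \+ (g \o X).
  by apply/funext => t /=; rewrite mulrC.
rewrite covarianceDl//; last by apply: Lfun_scale; rewrite ?ler1n.
rewrite covarianceZl//.
rewrite fineD ?fineM ?fin_numM ?covariance_fin_num//.
Qed.

Lemma variance_form_ge0 f : 0 <= variance_form f f.
Proof. by rewrite fine_ge0// variance_ge0. Qed.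

(** Once [g] is centred, its inner product with [f] is a covariance, which translates L2
    orthogonality into the form used by the optimisation. *)
Lemma variance_formE f g : L2 X f -> L2 X g ->
  (\int[P]_t (g (X t))%:E = 0)%E ->
  (\int[P]_t (f (X t) * g (X t))%:E = (variance_form f g)%:E)%E.
Proof.
move=> /L2_comp fL /L2_comp gL g0; rewrite /variance_form.
have PT : P setT \is a fin_num by exact: fin_num_measure.
have f1 := Lfun_subset12 PT fL; have g1 := Lfun_subset12 PT gL.
have fg := Lfun2_mul_Lfun1 fL gL.
rewrite fineK ?covariance_fin_num// covarianceE//.
by rewrite unlock g0 mule0 sube0.
Qed.

End variance_form.

(** * Vanishing on the orthogonal complement, and the optimisation carried out in L2 *)

Theorem theorem4p1 (R : realType) (d : measure_display) (T : measurableType d)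
  (P : probability T R) (p : nat) (YT : pmetricType R)
  (X : {RV P >-> rvec R p}) (Y Ybar Ytil : {RV P >-> borel YT})
  (OmegaX : set (rvec R p)) (OmegaY : set (borel YT))
  (hX : forall t, OmegaX (X t)) (hY : forall t, OmegaY (Y t))
  (hsep : separable YT)
  (kappa : R.-pker (borel YT) ~> rvec R p)
  (hkappa : is_cond_distribution X Y kappa)
  (nu : {sigma_finite_measure set (rvec R p) -> \bar R})
  (hdom : forall y, OmegaY y -> kappa y `<< nu)
  (hcopies : indep_copies X Y Ybar Ytil)
  (hmom : ('E_P[(fun t => mdist (Y t : YT) (Ytil t) ^+ 2)%R] < +oo)%E)
  (G : set (set T)) (hG : central_field X Y G) :
  (forall g, central_class_orth X G g -> FCCov X Y Ybar Ytil g = 0%E) /\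
  (forall m : nat, (0 < m)%N ->
   FCCov_rank_ge X Y Ybar Ytil m ->
   forall f : 'I_m -> rvec R p -> R, optimal X Y Ybar Ytil f ->
   forall j, central_class X G (f j)).
Proof.
have suffG := hG.1.
have FCCov0 g : central_class_orth X G g -> FCCov X Y Ybar Ytil g = 0%E.
  move=> gS; have [gL _] := gS; rewrite (FCCovE hsep hcopies)//.
  under eq_integral do
    rewrite (cov_ind_orth _ gL (fun A => central_orth_indic suffG gS)).
  by under eq_integral do rewrite expr0n; exact: integral0.
split=> // m _ [w [wL w_gt0]] f [[fL fI] f_max] j.
(* By double orthogonality it suffices that [f j] is uncorrelated with every [g] orthogonal to the
   central class. *)
apply: (central_class_double_orth suffG (fL j)) => g gS.
have [gL _] := gS.
rewrite (variance_formE (fL j) gL (central_orth_integral0 suffG gS)).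
congr EFin.
have le12 : (1 <= 2%:E :> \bar R)%E by rewrite lee1n.
(* Elements of [V] are functions, not classes modulo null sets, and [c] vanishes on constants; [c]
   is thus only semidefinite, which is why [cb0] is established below. *)
pose V := LfunType (distribution P X) le12.
have VL (u : V) : L2 X u by exact: LfunP.
pose toV h (hL : L2 X h) : V := Lfun_Sub le12 hL.
pose c (u v : V) := variance_form X u v.
pose b (u v : V) := cov_form X Y Ybar Ytil u v.
have cC u v : c u v = c v u by rewrite /c /variance_form covarianceC.
have bC u v : b u v = b v u.
  by apply: eq_Rintegral => t _; rewrite mulrC.
have cP a u v x : c (a *: u + v) x = a * c u x + c v x.
  exact: (variance_form_linear a (VL u) (VL v) (VL x)).
have bP a u v x : b (a *: u + v) x = a * b u x + b v x.
  exact: (cov_form_linear hsep hcopies a (VL u) (VL v) (VL x)).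
have c_ge0 u : 0 <= c u u by exact: variance_form_ge0.
have b_ge0 u : 0 <= b u u.
  by apply: Rintegral_ge0 => t _; rewrite -expr2 sqr_ge0.
have FCCovb u : FCCov X Y Ybar Ytil (u : V) = (b u u)%:E.
  exact: FCCov_form.
have cb0 u : c u u = 0 -> b u u = 0.
  move=> cu0; have V0 : 'V_P[u \o X] = 0%E.
    rewrite -(fineK (variance_fin_num (L2_comp (VL u)))).
    by rewrite -[fine _]/(c u u) cu0.
  rewrite /b /cov_form.
  under eq_Rintegral do rewrite (cov_ind_variance0 Y hsep _ (VL u) V0) mul0r.
  by rewrite Rintegral_cst// mul0r.
pose F i := toV _ (fL i).
have FI i k : c (F i) (F k) = (i == k)%:R.
  by move/matrixP : fI => /(_ i k); rewrite !mxE.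
have F_opt (h : 'I_m -> V) : (forall i k, c (h i) (h k) = (i == k)%:R) ->
    \sum_i b (h i) (h i) <= \sum_i b (F i) (F i).
  move=> hI; rewrite -lee_fin -!sumEFin.
  under eq_bigr do rewrite -FCCovb.
  under [leRHS]eq_bigr do rewrite -FCCovb.
  apply: f_max; split => //; apply/matrixP => i k; rewrite !mxE.
  exact: hI.
have b_rank : exists u : 'I_m -> V, forall a : 'rV[R]_m, a != 0 ->
    0 < b (\sum_i a ord0 i *: u i) (\sum_i a ord0 i *: u i).
  exists (fun i => toV _ (wL i)) => a /w_gt0.
  (* [FCCov_rank_ge] uses pointwise combinations; evaluation at a point is additive on [V], so they
     are the combinations taken in [V]. *)
  rewrite -lte_fin -FCCovb; congr (_ < FCCov _ _ _ _ _)%E.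
  apply/funext => x.
  by rewrite (big_morph (fun u : V => u x) (id1 := 0) (op1 := +%R)).
(* By the first claim [g] lies in the kernel of [b], and optimality forces every [f i] to be
   uncorrelated with that kernel. *)
apply: (optimal_orth_kernel cC bC cP bP c_ge0 b_ge0 cb0 FI F_opt b_rank
  (g := toV g gL)).
by apply: EFin_inj; rewrite -FCCovb FCCov0.
Qed.
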